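(* Let $E=(E^0,E^1,r,s)$ be a row-finite directed graph satisfying Condition (L). Let $J$ be a regular, gauge-invariant ideal in $C^*(E)$. Then the graph $E/J$ satisfies Condition (L).
   Context: A directed graph $E=(E^0,E^1,r,s)$ has vertex set $E^0$, edge set $E^1$, and range and source maps $r,s:E^1\to E^0$; it is row-finite if $r^{-1}(v)$ is finite for every $v\in E^0$. A path of length $N\geq 1$ is a sequence of edges $\alpha=\alpha_1\alpha_2\cdots\alpha_N$ with $s(\alpha_i)=r(\alpha_{i+1})$; put $r(\alpha)=r(\alpha_1)$ and $s(\alpha)=s(\alpha_N)$. Such a path is a cycle if $r(\alpha)=s(\alpha)$. $E$ satisfies Condition (L) if every cycle has an entry: for every cycle $\alpha=\alpha_1\cdots\alpha_n$ there exist an index $i$ and an edge $e\in E^1$ with $e\neq\alpha_i$ and $r(e)=r(\alpha_i)$. $C^*(E)$ is the universal $C^*$-algebra generated by a Cuntz-Krieger $E$-family $\{s_e,p_v: e\in E^1, v\in E^0\}$: the $p_v$ are mutually orthogonal projections, the $s_e$ are partial isometries, $s_e^*s_e=p_{s(e)}$ for all $e\in E^1$, and $p_v=\sum_{r(e)=v}s_es_e^*$ whenever $r^{-1}(v)\neq\emptyset$ (the convention of Raeburn's monograph). The gauge action $\gamma$ of $\mathbb{T}$ on $C^*(E)$ is determined by $\gamma_z(s_e)=zs_e$, $\gamma_z(p_v)=p_v$. Ideals are closed and two-sided; an ideal $J$ is gauge-invariant if $\gamma_z(J)=J$ for all $z\in\mathbb{T}$. For a subset $X$ of a $C^*$-algebra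 $A$, $X^\perp=\{a\in A: ax=xa=0\text{ for all }x\in X\}$, and $X^{\perp\perp}=(X^\perp)^\perp$. An ideal $J$ of $A$ is regular if $J=J^{\perp\perp}$. For an ideal $J$ of $C^*(E)$, $H(J)=\{v\in E^0: p_v\in J\}$, and $E/J$ is the largest subgraph of $E$ with no vertex in $H(J)$: $E/J=(E^0\setminus H(J),\ E^1\setminus s^{-1}(H(J)),\ r,\ s)$. *)

(* Defs.v *)
From HB Require Import structures.
From mathcomp Require Import all_boot all_order all_algebra.
From mathcomp Require Import all_classical all_reals all_analysis.
From mathcomp Require Import complex.

Set Implicit Arguments.
Unset Strict Implicit.
Unset Printing Implicit Defensive.

Import Order.TTheory GRing.Theory Num.Theory.
Import numFieldNormedType.Exports.

Local Open Scope classical_set_scope.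
Local Open Scope complex_scope.
Local Open Scope ring_scope.

(* C*-algebras need not be unital, so the product cannot be the one of a
   MathComp ring and is part of the structure below.  The norm is that of a
   normed R[i]-module, hence takes its (nonnegative real) values in R[i]. *)

HB.mixin Record CompleteNormedModule_isCstar (R : realType) (A : Type)
    of CompleteNormedModule R[i] A := {
  cmul : A -> A -> A ;
  cstar : A -> A ;
  cmulA : associative cmul ;
  cmulDl : left_distributive cmul +%R ;
  cmulDr : right_distributive cmul +%R ;
  cmulZl : forall (c : R[i]) (x y : A), cmul (c *: x) y = c *: cmul x y ;
  cmulZr : forall (c : R[i]) (x y : A), cmul x (c *: y) = c *: cmul x y ;
  cstarK : involutive cstar ;
  cstarD : {morph cstar : x y / x + y} ;
  cstarZ : forall (c : R[i]) (x : A), cstar (c *: x) = Num.conj c *: cstar x ;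
  cstarM : forall x y : A, cstar (cmul x y) = cmul (cstar y) (cstar x) ;
  norm_cmul : forall x y : A, `|cmul x y| <= `|x| * `|y| ;
  norm_cstar_cmul : forall x : A, `|cmul (cstar x) x| = `|x| ^+ 2
}.

#[short(type="cstarAlgType")]
HB.structure Definition CstarAlgebra (R : realType) :=
  { A of CompleteNormedModule R[i] A & CompleteNormedModule_isCstar R A }.

Declare Scope cstar_scope.
Delimit Scope cstar_scope with cstar.
Notation "x ** y" := (cmul x y)
  (at level 40, left associativity) : cstar_scope.
Notation "x ^#" := (cstar x) (at level 2, format "x ^#") : cstar_scope.
Local Open Scope cstar_scope.

Section CstarTheory.
Variables (R : realType) (A B : cstarAlgType R).
Implicit Types X J : set A.

Definition star_hom (f : A -> B) : Prop :=
  [/\ forall (c : R[i]) x y, f (c *: x + y) = c *: f x + f y,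
      forall x y, f (x ** y) = f x ** f y &
      forall x, f (x^#) = (f x)^#].

Definition linear_subspace X : Prop :=
  X 0 /\ forall (c : R[i]) x y, X x -> X y -> X (c *: x + y).

Definition cstar_subalgebra X : Prop :=
  [/\ closed X, linear_subspace X,
      forall x y, X x -> X y -> X (x ** y) & forall x, X x -> X (x^#)].

Definition cstar_ideal J : Prop :=
  [/\ closed J, linear_subspace J &
      forall a x, J x -> J (a ** x) /\ J (x ** a)].

Definition perp X : set A :=
  [set a | forall x, X x -> a ** x = 0 /\ x ** a = 0].

Definition regular_ideal J : Prop := cstar_ideal J /\ J = perp (perp J).

End CstarTheory.

Record digraph := Digraph {
  vertex : choiceType ;
  edge : choiceType ;
  rng : edge -> vertex ;
  src : edge -> vertex
}.

Section Graph.
Variable E : digraph.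

Definition row_finite : Prop :=
  forall v : vertex E, finite_set [set e : edge E | rng e = v].

(* Paths run against the arrows: a path a1 a2 ... has src a_i = rng a_(i+1).
   The nonempty path a1 ... aN is given as its first edge a1 and the list
   of the remaining ones. *)
Definition is_path (a : edge E) (l : seq (edge E)) : bool :=
  path (fun e f => src e == rng f) a l.

Definition is_cycle (a : edge E) (l : seq (edge E)) : Prop :=
  is_path a l /\ rng a = src (last a l).

Definition condition_L : Prop :=
  forall (a : edge E) (l : seq (edge E)), is_cycle a l ->
  exists f e : edge E, [/\ f \in a :: l, e <> f & rng e = rng f].

(* The largest subgraph with no vertex in H: the edges are those having
   neither endpoint in H. *)
Section Quotient.
Variable H : set (vertex E).

Definition quotient_vertex : choiceType := {v : vertex E | v \in ~` H}.
Definition quotient_edge : choiceType :=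
  {e : edge E | (src e \in ~` H) && (rng e \in ~` H)}.

Definition quotient_rng (e : quotient_edge) : quotient_vertex :=
  exist _ (rng (val e)) (proj2 (andP (valP e))).
Definition quotient_src (e : quotient_edge) : quotient_vertex :=
  exist _ (src (val e)) (proj1 (andP (valP e))).

Definition quotient_graph : digraph := Digraph quotient_rng quotient_src.

(* For hereditary H, in particular for {v | p_v \in J} with J an ideal, the
   edge set is E^1 \ s^-1(H). *)
Lemma quotient_edgeE :
  (forall e : edge E, H (rng e) -> H (src e)) ->
  [set val e | e in [set: quotient_edge]] = [set e : edge E | ~ H (src e)].
Proof.
move=> hH; apply/seteqP; split => [e [[f /= /andP[srcf rngf]] _ <-]|e /= He].
  exact: set_mem srcf.
have He' : (src e \in ~` H) && (rng e \in ~` H).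
  by apply/andP; split; apply: mem_set => // /hH.
by exists (exist _ e He').
Qed.
End Quotient.

End Graph.

Section GraphAlgebra.
Variables (R : realType) (E : digraph).

Definition projection (A : cstarAlgType R) (x : A) : Prop :=
  x ** x = x /\ x^# = x.

Definition partial_isometry (A : cstarAlgType R) (x : A) : Prop :=
  x ** x^# ** x = x.

Definition CK_family (A : cstarAlgType R)
    (s : edge E -> A) (p : vertex E -> A) : Prop :=
  [/\ (forall v, projection (p v)) /\
        (forall v w, v <> w -> p v ** p w = 0),
      forall e, partial_isometry (s e),
      forall e, (s e)^# ** s e = p (src e) &
      forall v, [set e | rng e = v] !=set0 ->
        p v = \sum_(e \in [set e | rng e = v]) (s e ** (s e)^#)].

Definition generates (A : cstarAlgType R)
    (s : edge E -> A) (p : vertex E -> A) : Prop :=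
  forall X : set A, cstar_subalgebra X ->
    (forall e, X (s e)) -> (forall v, X (p v)) -> X = setT.

(* A together with (s, p) is C*(E). *)
Definition graph_cstar_algebra (A : cstarAlgType R)
    (s : edge E -> A) (p : vertex E -> A) : Prop :=
  [/\ CK_family s p, generates s p &
      forall (B : cstarAlgType R) (t : edge E -> B) (q : vertex E -> B),
        CK_family t q ->
        exists phi : A -> B,
          [/\ star_hom phi, forall e, phi (s e) = t e &
              forall v, phi (p v) = q v]].

Variables (A : cstarAlgType R) (s : edge E -> A) (p : vertex E -> A).

(* Only the values gam z with |z| = 1 are relevant. *)
Definition gauge_action (gam : R[i] -> A -> A) : Prop :=
  [/\ forall z : R[i], `|z| = 1 -> star_hom (gam z),
      forall x, gam 1 x = x,
      forall (z w : R[i]) x, `|z| = 1 -> `|w| = 1 -> gam (z * w) x = gam z (gam w x),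
      forall (z : R[i]) e, `|z| = 1 -> gam z (s e) = z *: s e &
      forall (z : R[i]) v, `|z| = 1 -> gam z (p v) = p v].

Definition gauge_invariant (gam : R[i] -> A -> A) (J : set A) : Prop :=
  forall z : R[i], `|z| = 1 -> gam z @` J = J.

Definition ideal_vertices (J : set A) : set (vertex E) := [set v | J (p v)].

Definition ideal_quotient_graph (J : set A) : digraph :=
  quotient_graph (ideal_vertices J).

End GraphAlgebra.

(* Main.v *)
Require Import Defs.
From HB Require Import structures.
From mathcomp Require Import all_boot all_order all_algebra.
From mathcomp Require Import all_classical all_reals all_analysis.
From mathcomp Require Import complex.
From mathcomp Require Import ring lra zify.

(* A cycle of E/J without an entry in E/J has in E only entries from sources v
   with p_v in J.  Let p be the projection of a vertex of the cycle having such
   an entry e, and let I be the annihilator of J.  If p is in I then s_e lies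
   in both I and J, whence p_(src e) = 0, which is impossible in C*(E).

   To see that p is in I: since p is not in J, which is the annihilator of I,
   the corner p I p contains a self-adjoint x <> 0.  As I kills the entries of
   the cycle, going once around acts on p I as a unitary u, and a compression
   of x is approximated up to eps by a Laurent polynomial F in u.  If p were
   not in I, then averaging over the gauge action would bound each coefficient
   of an element of this kind by its distance to I.  The k-th power of F is at
   distance at most eps^k from I and has O(k) coefficients, so its norm on p I
   is O(k) eps^k; hence the norm of F there is at most 2 eps, and x = 0.  *)

Set Implicit Arguments.
Unset Strict Implicit.
Unset Printing Implicit Defensive.

Import Order.TTheory GRing.Theory Num.Theory.
Import numFieldNormedType.Exports.

Local Open Scope classical_set_scope.
Local Open Scope complex_scope.
Local Open Scope ring_scope.
Local Open Scope cstar_scope.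

(** * Linear identities *)

(** The obstacle is that [F] can be measured only modulo I, while it is applied to elements of I.
    Its coefficients are the sole link between the two, and their number is the price of crossing.
    Powers are formed by repeated squaring, because for self-adjoint [F] the C*-identity compares
    the actions of F and F^2 on p I. The argument stays inside [A]: the distance to I replaces the
    norm of A/I, and averages over two points of the circle replace the Haar integral, which leaves
    contractivity of each gauge automorphism as the analytic input. A Cuntz-Krieger family
    constrains the range projections only through their sum, so their orthogonality and s_e = p_(rng
    e) s_e must be extracted from the fact that this sum is a projection. As [A] may lack a unit,
    the positivity behind this is expressed as contractivity of 1 - h on a subspace. That no p_v
    vanishes comes from the universal property, applied to a concrete family on an l2 space; this is
    why bounded operators are made into a C*-algebra. *)

Section SquareZero.
Variables (K : comNzRingType) (V : lmodType K).

(* The square-zero extension of [K] by [V], a commutative ring in which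
   [ring] decides linear identities of [V]. *)
Definition sqzero : Type := (K * V)%type.
HB.instance Definition _ := GRing.Zmodule.on sqzero.

Definition sqzero_one : sqzero := (1, 0).
Definition sqzero_mul (x y : sqzero) : sqzero :=
  (x.1 * y.1, x.1 *: y.2 + y.1 *: x.2).

Fact sqzero_mulA : associative sqzero_mul.
Proof.
move=> x y z; congr pair => /=; first by rewrite mulrA.
by rewrite !scalerDr !scalerA addrA (mulrC z.1) (mulrC z.1).
Qed.

Fact sqzero_mulC : commutative sqzero_mul.
Proof. by move=> x y; congr pair => /=; [rewrite mulrC|rewrite addrC]. Qed.

Fact sqzero_mul1 : left_id sqzero_one sqzero_mul.
Proof.
by case=> a v; congr pair => /=; rewrite ?mul1r// scale1r scaler0 addr0.
Qed.

Fact sqzero_mulDl : left_distributive sqzero_mul +%R.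
Proof.
move=> x y z; congr pair => /=; first by rewrite mulrDl.
by rewrite scalerDl scalerDr addrACA.
Qed.

HB.instance Definition _ := GRing.Zmodule_isComPzRing.Build sqzero
  sqzero_mulA sqzero_mulC sqzero_mul1 sqzero_mulDl.

Definition sqzero_scalar (c : K) : sqzero := (c, 0).

Fact sqzero_scalar_zmod : zmod_morphism sqzero_scalar.
Proof. by move=> a b; congr pair; rewrite /= subr0. Qed.
Fact sqzero_scalar_mul : monoid_morphism sqzero_scalar.
Proof.
by split=> // a b; congr pair; rewrite /= !scaler0 addr0.
Qed.
HB.instance Definition _ :=
  GRing.isZmodMorphism.Build K sqzero sqzero_scalar sqzero_scalar_zmod.
HB.instance Definition _ :=
  GRing.isMonoidMorphism.Build K sqzero sqzero_scalar sqzero_scalar_mul.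

Definition sqzero_vec (v : V) : sqzero := (0, v).

Fact sqzero_vecB : zmod_morphism sqzero_vec.
Proof. by move=> a b; congr pair; rewrite /= subr0. Qed.
HB.instance Definition _ :=
  GRing.isZmodMorphism.Build V sqzero sqzero_vec sqzero_vecB.

Lemma sqzero_vec_inj : injective sqzero_vec.
Proof. by move=> x y []. Qed.

Lemma sqzero_vecZ c v : sqzero_vec (c *: v) = sqzero_scalar c * sqzero_vec v.
Proof. by congr pair; rewrite /= ?mulr0// scale0r addr0. Qed.

End SquareZero.

Section CstarLinear.
Variables (R : realType) (A : cstarAlgType R).

Definition cstar_vec (x : A) : sqzero A := sqzero_vec x.
Definition cstar_scalar (c : R[i]) : sqzero A := sqzero_scalar A c.

Lemma cstar_vec_inj (x y : A) : cstar_vec x = cstar_vec y -> x = y.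
Proof. exact: sqzero_vec_inj. Qed.
Lemma cstar_vecD (x y : A) : cstar_vec (x + y) = cstar_vec x + cstar_vec y.
Proof. exact: raddfD. Qed.
Lemma cstar_vecN (x : A) : cstar_vec (- x) = - cstar_vec x.
Proof. exact: raddfN. Qed.
Lemma cstar_vec0 : cstar_vec 0 = 0.
Proof. by []. Qed.
Lemma cstar_vecZ (c : R[i]) (x : A) :
  cstar_vec (c *: x) = cstar_scalar c * cstar_vec x.
Proof. exact: sqzero_vecZ. Qed.
Lemma cstar_scalarD (c d : R[i]) :
  cstar_scalar (c + d) = cstar_scalar c + cstar_scalar d.
Proof. exact: raddfD. Qed.
Lemma cstar_scalarN (c : R[i]) : cstar_scalar (- c) = - cstar_scalar c.
Proof. exact: raddfN. Qed.
Lemma cstar_scalarM (c d : R[i]) :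
  cstar_scalar (c * d) = cstar_scalar c * cstar_scalar d.
Proof. exact: rmorphM. Qed.
Lemma cstar_scalar1 : cstar_scalar 1 = 1.
Proof. by []. Qed.
Lemma cstar_scalar0 : cstar_scalar 0 = 0.
Proof. by []. Qed.
End CstarLinear.

Ltac linear_ring := apply: cstar_vec_inj;
  rewrite ?(cstar_vecD, cstar_vecN, cstar_vec0, cstar_vecZ, cstar_scalarD,
    cstar_scalarN, cstar_scalarM, cstar_scalar1, cstar_scalar0) /=; ring.

(** * Real-valued norms and limits with explicit rates *)

Section Norm.
Variables (R : realType) (V : normedModType R[i]).
Implicit Types x y : V.

Definition nrm x : R := complex.Re `|x|.

Lemma nrmE x : `|x| = (nrm x)%:C.
Proof. by rewrite /nrm RRe_real// normr_real. Qed.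

Lemma nrm_ge0 x : 0 <= nrm x.
Proof. by rewrite -(lecR 0) -nrmE normr_ge0. Qed.

Lemma ler_nrmD x y : nrm (x + y) <= nrm x + nrm y.
Proof. by rewrite -lecR rmorphD/= -!nrmE ler_normD. Qed.

Lemma nrmN x : nrm (- x) = nrm x.
Proof. by rewrite /nrm normrN. Qed.

Lemma nrmC x y : nrm (x - y) = nrm (y - x).
Proof. by rewrite -nrmN opprB. Qed.

Lemma ler_nrmB x y : nrm (x - y) <= nrm x + nrm y.
Proof. by rewrite -(nrmN y) ler_nrmD. Qed.

Lemma ler_nrm_trans x y z : nrm (x - z) <= nrm (x - y) + nrm (y - z).
Proof. by rewrite -{1}(subrK y x) -addrA ler_nrmD. Qed.

Lemma nrm0 : nrm (0 : V) = 0.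
Proof. by rewrite /nrm normr0. Qed.

Lemma nrm0_eq0 x : nrm x = 0 -> x = 0.
Proof. by move=> x0; apply/normr0_eq0; rewrite nrmE x0. Qed.

Lemma nrm_le0 x : nrm x <= 0 -> x = 0.
Proof. by move=> x0; apply: nrm0_eq0; apply/eqP; rewrite eq_le x0 nrm_ge0. Qed.

Lemma nrmZ (c : R[i]) x : nrm (c *: x) = complex.Re `|c| * nrm x.
Proof.
rewrite /nrm normrZ nrmE -[in LHS](RRe_real (normr_real c)).
by rewrite -rmorphM.
Qed.

Lemma nrmZR (a : R) x : nrm (a%:C *: x) = `|a| * nrm x.
Proof. by rewrite nrmZ normc_def/= expr0n addr0 sqrtr_sqr. Qed.

Lemma nrm_small x : (forall e, 0 < e -> nrm x <= e) -> x = 0.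
Proof.
by move=> h; apply: nrm_le0; apply/ler_addgt0Pr => e e0; rewrite add0r h.
Qed.

Lemma nrm_sum (I : Type) (r : seq I) (P : pred I) (F : I -> V) :
  nrm (\sum_(i <- r | P i) F i) <= \sum_(i <- r | P i) nrm (F i).
Proof.
elim/big_ind2 : _ => [|x a y b xa yb|//]; first by rewrite nrm0.
by rewrite (le_trans (ler_nrmD _ _))// lerD.
Qed.

Lemma near_nrmP (F : set_system V) {FF : Filter F} (l : V) :
  F --> l <-> forall e, 0 < e -> \forall x \near F, nrm (l - x) < e.
Proof.
split=> [/cvgrPdist_lt h e e0|h].
  have /h : 0 < e%:C by rewrite ltcR.
  by apply: filterS => x; rewrite nrmE ltcR.
apply/cvgrPdist_lt => e e0.
have eE : e = (complex.Re e)%:C by rewrite RRe_real// gtr0_real.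
have /h : 0 < complex.Re e by rewrite -ltcR -eE.
by apply: filterS => x; rewrite nrmE eE ltcR.
Qed.

End Norm.

Lemma ball_nrmP (R : realType) (V : normedModType R[i]) (x y : V) (e : R) :
  ball x e%:C y <-> nrm (x - y) < e.
Proof. by rewrite -ball_normE /= nrmE ltcR. Qed.

Lemma closed_nrmP (R : realType) (V : normedModType R[i]) (X : set V) :
  closed X <-> forall x, (forall e, 0 < e -> exists2 y, X y & nrm (x - y) < e) -> X x.
Proof.
split=> [cX x h|h x cx].
  apply: cX => B /nbhs_normP[e /= e0 eB].
  have eE : e = (complex.Re e)%:C by rewrite RRe_real// gtr0_real.
  have /h[y Xy xy] : 0 < complex.Re e by rewrite -ltcR -eE.
  by exists y; split => //; apply: eB => /=; rewrite nrmE eE ltcR.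
apply: h => e e0.
have /cx[y [Xy xy]] : nbhs x (ball x e%:C).
  by apply: nbhsx_ballx; rewrite ltcR.
by exists y => //; apply/ball_nrmP.
Qed.

Lemma cauchy_seq_lim (R : realType) (V : completeNormedModType R[i])
    (g : nat -> V) (e : nat -> R) :
  (forall n m, (n <= m)%N -> nrm (g m - g n) <= e n) ->
  (forall d, 0 < d -> exists n, e n < d) ->
  exists l, forall n, nrm (l - g n) <= e n.
Proof.
move=> ge e0.
have gC : cvg (g @ \oo).
  apply/cauchy_cvgP/cauchy_exP => d d0.
  have dE : d = (complex.Re d)%:C by rewrite RRe_real// gtr0_real.
  have /e0[n nd] : 0 < complex.Re d by rewrite -ltcR -dE.
  exists (g n); exists n => // m /= nm.
  rewrite -ball_normE/= nrmE dE ltcR (le_lt_trans _ nd)//.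
  by rewrite nrmC ge.
exists (lim (g @ \oo)) => n; apply/ler_addgt0Pr => d d0.
have /near_nrmP/(_ _ d0)[m _ hm] := gC.
have := hm (maxn m n) (leq_maxl _ _) => /ltW hm'.
rewrite (le_trans (ler_nrm_trans _ (g (maxn m n)) _))// addrC.
by rewrite lerD// ge// leq_maxr.
Qed.

(** * C*-algebras *)

Section CstarBasics.
Variables (R : realType) (A : cstarAlgType R).
Implicit Types x y z : A.

Lemma cmul0l y : 0 ** y = 0 :> A.
Proof. by have := cmulZl 0 (0 : A) y; rewrite !scale0r. Qed.

Lemma cmul0r x : x ** 0 = 0 :> A.
Proof. by have := cmulZr 0 x (0 : A); rewrite !scale0r. Qed.

Lemma cmulNl x y : (- x) ** y = - (x ** y).
Proof. by rewrite -scaleN1r cmulZl scaleN1r. Qed.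

Lemma cmulNr x y : x ** (- y) = - (x ** y).
Proof. by rewrite -scaleN1r cmulZr scaleN1r. Qed.

Lemma cmulBl x y z : (x - y) ** z = x ** z - y ** z.
Proof. by rewrite cmulDl cmulNl. Qed.

Lemma cmulBr x y z : x ** (y - z) = x ** y - x ** z.
Proof. by rewrite cmulDr cmulNr. Qed.

Lemma cmul_suml (I : Type) (r : seq I) (P : pred I) (F : I -> A) y :
  (\sum_(i <- r | P i) F i) ** y = \sum_(i <- r | P i) (F i ** y).
Proof.
by elim/big_rec2 : _ => [|i a b _ <-]; rewrite ?cmul0l// cmulDl.
Qed.

Lemma cmul_sumr (I : Type) (r : seq I) (P : pred I) (F : I -> A) x :
  x ** (\sum_(i <- r | P i) F i) = \sum_(i <- r | P i) (x ** F i).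
Proof.
by elim/big_rec2 : _ => [|i a b _ <-]; rewrite ?cmul0r// cmulDr.
Qed.

Lemma cstar0 : (0 : A)^# = 0.
Proof. by have := cstarZ 0 (0 : A); rewrite conjC0 !scale0r. Qed.

Lemma cstarN x : (- x)^# = - x^#.
Proof. by rewrite -scaleN1r cstarZ rmorphN1 scaleN1r. Qed.

Lemma cstarB x y : (x - y)^# = x^# - y^#.
Proof. by rewrite cstarD cstarN. Qed.

Lemma cstar_sum (I : Type) (r : seq I) (P : pred I) (F : I -> A) :
  (\sum_(i <- r | P i) F i)^# = \sum_(i <- r | P i) (F i)^#.
Proof. by elim/big_rec2 : _ => [|i a b _ <-]; rewrite ?cstar0// cstarD. Qed.

Lemma nrm_cmul x y : nrm (x ** y) <= nrm x * nrm y.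
Proof. by rewrite -lecR rmorphM/= -!nrmE norm_cmul. Qed.

Lemma nrm_star_cmul x : nrm (x^# ** x) = nrm x ^+ 2.
Proof. by apply: complexI; rewrite rmorphXn/= -!nrmE norm_cstar_cmul. Qed.

Lemma nrm_star x : nrm x^# = nrm x.
Proof.
have le y : nrm y <= nrm y^#.
  have [->|y0] := eqVneq (nrm y) 0; first exact: nrm_ge0.
  have yp : 0 < nrm y by rewrite lt_neqAle eq_sym y0 nrm_ge0.
  by rewrite -(ler_pM2r yp) -expr2 -nrm_star_cmul nrm_cmul.
by apply/le_anti; rewrite -{2}(cstarK x) !le.
Qed.

Lemma cstar_cmul_eq0 x : x^# ** x = 0 -> x = 0.
Proof.
move=> xx; apply: nrm0_eq0; apply/eqP.
by rewrite -sqrf_eq0 -nrm_star_cmul xx nrm0.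
Qed.

Lemma half_dbl x : (2^-1 : R[i]) *: (x + x) = x.
Proof. by rewrite scalerDr -scalerDl -[2^-1]mul1r -splitr scale1r. Qed.

Lemma nrm_half x : nrm ((2^-1 : R[i]) *: x) = 2^-1 * nrm x.
Proof.
have -> : (2^-1 : R[i]) = (2^-1)%:C by rewrite fmorphV rmorph_nat.
by rewrite nrmZR gtr0_norm// invr_gt0.
Qed.

Definition selfadjoint x := x^# = x.

Lemma conj_half : Num.conj (2^-1 : R[i]) = 2^-1.
Proof. by rewrite fmorphV rmorph_nat. Qed.

(* The fixpoint of the contraction [g |-> (h^2 + g^2) / 2] of the ball of
   radius [nrm h ^+ 2] satisfies [(1 - g)^2 = 1 - h^2]. *)
Lemma sqrt_one_sub_square (h : A) : selfadjoint h -> nrm h < 1 ->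
  exists g, [/\ selfadjoint g, h ** g = g ** h & g + g - g ** g = h ** h].
Proof.
move=> hs h1; pose T (g : A) : A := (2^-1 : R[i]) *: (h ** h + g ** g).
pose c := nrm h ^+ 2.
have c0 : 0 <= c by rewrite exprn_ge0// nrm_ge0.
have c1 : c < 1 by rewrite expr_lt1 ?nrm_ge0.
have hh : nrm (h ** h) <= c by rewrite /c expr2 nrm_cmul.
pose g n := iter n T 0.
have gS n : g n.+1 = T (g n) by [].
have gc n : nrm (g n) <= c.
  elim: n => [|n IH]; first by rewrite /g/= nrm0.
  rewrite gS /T nrm_half.
  have : nrm (h ** h + g n ** g n) <= c + c.
    rewrite (le_trans (ler_nrmD _ _))// lerD//.
    rewrite (le_trans (nrm_cmul _ _))// (le_trans (ler_pM _ _ IH IH)) ?nrm_ge0//.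
    by rewrite ler_piMr// ltW.
  lra.
have TB x y : nrm x <= c -> nrm y <= c -> nrm (T x - T y) <= c * nrm (x - y).
  move=> xc yc; rewrite /T -scalerBr nrm_half opprD addrACA subrr add0r.
  have -> : x ** x - y ** y = x ** (x - y) + (x - y) ** y.
    by rewrite cmulBr cmulBl addrA subrK.
  have := ler_nrmD (x ** (x - y)) ((x - y) ** y).
  have := nrm_cmul x (x - y); have := nrm_cmul (x - y) y.
  have := nrm_ge0 (x - y); nra.
have gd n : nrm (g n.+1 - g n) <= c ^+ n.+1.
  elim: n => [|n IH]; first by rewrite expr1 /g/= subr0 (gc 1%N).
  by apply: (le_trans (TB _ _ (gc n.+1) (gc n))); rewrite exprS ler_wpM2l.
have c1' : 0 < 1 - c by rewrite subr_gt0.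
pose e n := c ^+ n.+1 / (1 - c).
have lim d : 0 < d -> exists n, e n < d.
  move=> d0; have c1n : `|c| < 1 by rewrite ger0_norm.
  have := cvg_expr c1n; move/cvgrPdist_lt => /(_ (d * (1 - c))).
  rewrite mulr_gt0// => /(_ isT)[n _ hn].
  exists n; rewrite /e ltr_pdivrMr//; have := hn n.+1 (leqnSn _).
  by rewrite sub0r normrN ger0_norm// exprn_ge0.
have [|l le] := @cauchy_seq_lim _ A g e _ lim.
  move=> n m /subnK <-; move: (m - n)%N => k {m}.
  (* The factor 1 - c^k is the exact partial sum of the geometric series, which makes the bound
     inductive. *)
  suff : nrm (g (k + n)%N - g n) <= e n * (1 - c ^+ k).
    move/le_trans; apply; rewrite ler_piMr//.
      by apply: divr_ge0; [exact: exprn_ge0|exact: ltW].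
    by rewrite lerBlDr lerDl exprn_ge0.
  elim: k => [|k IH]; first by rewrite subrr nrm0 expr0 subrr mulr0.
  rewrite addSn (le_trans (ler_nrm_trans _ (g (k + n)%N) _))//.
  rewrite (le_trans (lerD (gd _) IH))// le_eqVlt; apply/orP; left; apply/eqP.
  rewrite /e -addnS exprD !exprS; field.
  by rewrite gt_eqF.
have gsa n : selfadjoint (g n).
  elim: n => [|n IH]; first by rewrite /selfadjoint cstar0.
  by rewrite gS /T /selfadjoint cstarZ conj_half cstarD !cstarM hs IH.
have gcom n : h ** g n = g n ** h.
  elim: n => [|n IH]; first by rewrite cmul0l cmul0r.
  by rewrite gS /T cmulZr cmulZl cmulDr cmulDl !cmulA IH -(cmulA (g n)) IH cmulA.
have lc : nrm l <= c.
  apply/ler_addgt0Pr => d /lim[n nd].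
  have := ler_nrmD (l - g n) (g n); rewrite subrK.
  have := gc n; have := le n; lra.
exists l; split.
- apply/eqP; rewrite -subr_eq0; apply/eqP/nrm_small => d d0.
  have [|n nd] := lim (d / 2); first by rewrite divr_gt0.
  rewrite (le_trans (ler_nrm_trans _ (g n) _))// -{1}(gsa n) -cstarB nrm_star.
  have := le n; rewrite (nrmC (g n)); lra.
- apply/eqP; rewrite -subr_eq0; apply/eqP/nrm_small => d d0.
  have [|n nd] := lim (d / 2); first by rewrite divr_gt0.
  rewrite (le_trans (ler_nrm_trans _ (h ** g n) _))// {2}gcom -cmulBr -cmulBl.
  have := nrm_cmul h (l - g n); have := nrm_cmul (g n - l) h.
  have := le n; rewrite (nrmC (g n)); have := nrm_ge0 h; have := nrm_ge0 (l - g n).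
  nra.
- have lT : l = T l.
    apply/eqP; rewrite -subr_eq0; apply/eqP/nrm_small => d d0.
    have [|n nd] := lim (d / 2); first by rewrite divr_gt0.
    apply: le_trans (ler_nrm_trans _ (g n.+1) _) _.
    have := TB _ _ (gc n) lc; rewrite -gS (nrmC (g n)).
    have := le n; have := le n.+1.
    have : e n.+1 <= e n.
      rewrite /e ler_pM2r ?invr_gt0// exprS.
      by apply: ler_piMl; [exact: exprn_ge0|exact: ltW].
    have := nrm_ge0 (l - g n); nra.
  rewrite {1 2}lT /T -scalerDr half_dbl addrK//.
Qed.

End CstarBasics.

(** * Contractivity of homomorphisms and positivity *)

Section Contractive.
Variables (R : realType) (A : cstarAlgType R).
Implicit Types x y z a b v : A.

(** The last hypothesis makes a* v self-adjoint, so the cross terms of the square cancel, as in |cos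
    + i sin|^2. *)
Lemma nrm_skew_sum (c : R[i]) a v :
  Num.conj c = - c -> c * c = -1 -> a^# ** v = v^# ** a ->
  nrm (a + c *: v) ^+ 2 = nrm (a^# ** a + v^# ** v).
Proof.
move=> cc c2 av; rewrite -nrm_star_cmul; congr nrm.
rewrite cstarD cstarZ cc cmulDr !cmulDl !cmulZl !cmulZr scalerA av mulNr c2 opprK.
linear_ring.
Qed.

Lemma conj_i_skew : Num.conj ('i : R[i]) = - 'i.
Proof. by apply/eqP; rewrite eq_complex /= oppr0 !eqxx. Qed.

Lemma conj_real (t : R) : Num.conj t%:C = t%:C.
Proof. by apply/eqP; rewrite eq_complex /= oppr0 !eqxx. Qed.

Lemma i_sq : ('i : R[i]) * 'i = -1.
Proof. by rewrite -expr2 sqr_i. Qed.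

(* With [1] adjoined, [k + i (1 - g)] and its adjoint are isometries. *)
Lemma nrm_cos_le1 (k g : A) : selfadjoint k -> selfadjoint g ->
  k ** g = g ** k -> g + g - g ** g = k ** k -> nrm k <= 1.
Proof.
move=> ks gs kg gk.
have iso (c : R[i]) b : Num.conj c = - c -> c * c = -1 ->
    nrm (k ** b + c *: (b - g ** b)) = nrm b.
  move=> cc c2.
  apply/eqP; rewrite -(eqrXn2 (n := 2)) ?nrm_ge0//; apply/eqP.
  rewrite nrm_skew_sum//; last first.
    by rewrite cstarB !cstarM ks gs cmulBr cmulBl !cmulA -(cmulA _ k g) kg !cmulA.
  rewrite -nrm_star_cmul; congr nrm.
  rewrite cstarB !cstarM ks gs cmulBr !cmulBl -cmulA (cmulA k) -gk.
  rewrite !cmulBl !cmulBr !cmulDl !cmulDr !cmulA.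
  linear_ring.
have kb b : nrm (k ** b) <= nrm b.
  rewrite -[k ** b]half_dbl nrm_half.
  have := iso 'i b conj_i_skew i_sq.
  have := iso (- 'i) b; rewrite rmorphN/= conj_i_skew mulrNN i_sq => /(_ erefl erefl).
  set w := b - _.
  have -> : k ** b + k ** b = (k ** b + - 'i *: w) + (k ** b + 'i *: w).
    linear_ring.
  have := ler_nrmD (k ** b + - 'i *: w) (k ** b + 'i *: w); lra.
have := kb k; rewrite -{1}ks nrm_star_cmul; have := nrm_ge0 k; nra.
Qed.

End Contractive.

Section StarHom.
Variables (R : realType) (A B : cstarAlgType R) (f : A -> B).
Hypothesis fH : star_hom f.

Lemma star_homD x y : f (x + y) = f x + f y.
Proof. by have [fl _ _] := fH; rewrite -[x]scale1r fl !scale1r. Qed.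

Lemma star_hom0 : f 0 = 0.
Proof. by apply/eqP; rewrite -(subrr (f 0)) eq_sym subr_eq -star_homD addr0. Qed.

Lemma star_homZ (c : R[i]) x : f (c *: x) = c *: f x.
Proof. by have [fl _ _] := fH; rewrite -[c *: x]addr0 fl star_hom0 addr0. Qed.

Lemma star_homB x y : f (x - y) = f x - f y.
Proof. by rewrite star_homD -scaleN1r star_homZ scaleN1r. Qed.

Lemma star_hom_sum (I : Type) (r : seq I) (P : pred I) (F : I -> A) :
  f (\sum_(i <- r | P i) F i) = \sum_(i <- r | P i) f (F i).
Proof.
by elim/big_rec2 : _ => [|i a b _ <-]; rewrite ?star_hom0// star_homD.
Qed.

(** An element g with (1 - g)^2 = 1 - h^2 certifies algebraically that h behaves like a cosine.
    Self-adjoint h of norm below 1 have such a g, homomorphisms preserve it, and [nrm_cos_le1] reads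
    the bound off the image. Scaling and the C*-identity give the general case. *)
Lemma star_hom_contractive x : nrm (f x) <= nrm x.
Proof.
have [_ fM fS] := fH.
have lt1 h : selfadjoint h -> nrm h < 1 -> nrm (f h) <= 1.
  move=> hs /(sqrt_one_sub_square hs)[g [gs hg gE]].
  apply: (@nrm_cos_le1 _ _ _ (f g)).
  - by rewrite /selfadjoint -fS hs.
  - by rewrite /selfadjoint -fS gs.
  - by rewrite -!fM hg.
  - by rewrite -!fM -star_homD -star_homB gE.
have sa h : selfadjoint h -> nrm (f h) <= nrm h.
  move=> hs; apply/ler_addgt0Pr => d d0.
  have r0 : 0 < nrm h + d by rewrite ltr_wpDl ?nrm_ge0.
  set r := nrm h + d in r0 *.
  have := lt1 ((r^-1)%:C *: h); rewrite star_homZ !nrmZR gtr0_norm ?invr_gt0//.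
  rewrite ![_^-1 * _]mulrC ltr_pdivrMr// ler_pdivrMr// !mul1r; apply.
    by rewrite /selfadjoint cstarZ hs conj_real.
  by rewrite /r ltrDl.
rewrite -(ler_pXn2r (n := 2)) ?nnegrE ?nrm_ge0// -!nrm_star_cmul -fS -fM.
by rewrite sa// /selfadjoint cstarM cstarK.
Qed.

End StarHom.

(** * Positivity expressed by contractivity *)

Section Positivity.
Variables (R : realType) (A : cstarAlgType R).
Implicit Types (x y z a b v : A) (V : set A).

Definition perturb y (c : R[i]) b := b + c *: (y ** b).

(** A real function y with |1 + y| <= 1 and |1 - y| <= 1 is zero. The noncommutative argument is of
    Liouville type: 1 + c y turns out contractive for every complex c, which bounds c y uniformly.
    The subspace [V] stands in for a unit: these operators act on it by left multiplication. *)
Lemma contractive_both_eq0 V y : linear_subspace V ->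
  (forall b, V b -> V (y ** b)) -> selfadjoint y ->
  (forall b, V b -> nrm (b + y ** b) <= nrm b) ->
  (forall b, V b -> nrm (b - y ** b) <= nrm b) ->
  forall b, V b -> y ** b = 0.
Proof.
move=> [_ VL] yV ys yp ym.
have VD a b : V a -> V b -> V (a + b).
  by move=> Va Vb; rewrite -[a]scale1r; apply: VL.
(* Since 2 (1 + y^2) = (1 + y)^2 + (1 - y)^2, the operator 1 + y^2 is contractive on [V], and |(1 +
   c y) b|^2 = |b* (1 + y^2) b|. *)
have skew (c : R[i]) b : V b -> Num.conj c = - c -> c * c = -1 ->
    nrm (b + c *: (y ** b)) <= nrm b.
  move=> Vb cc c2; rewrite -(ler_pXn2r (n := 2)) ?nnegrE ?nrm_ge0//.
  rewrite nrm_skew_sum//; last by rewrite cstarM ys cmulA.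
  have -> : b^# ** b + (y ** b)^# ** (y ** b) = b^# ** (b + y ** (y ** b)).
    by rewrite cstarM ys cmulDr !cmulA.
  rewrite (le_trans (nrm_cmul _ _))// nrm_star expr2 ler_wpM2l ?nrm_ge0//.
  rewrite -[_ + _]half_dbl nrm_half.
  have -> : b + y ** (y ** b) + (b + y ** (y ** b)) =
      (b + y ** b + y ** (b + y ** b)) + (b - y ** b - y ** (b - y ** b)).
    rewrite !(cmulDr, cmulNr); linear_ring.
  have V1 : V (b + y ** b) by apply: VD; last exact: yV.
  have V2 : V (b - y ** b).
    by rewrite addrC -scaleN1r; apply: VL => //; exact: yV.
  have := ler_nrmD (b + y ** b + y ** (b + y ** b)) (b - y ** b - y ** (b - y ** b)).
  have := yp _ V1; have := ym _ V2; have := yp _ Vb; have := ym _ Vb; lra.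
have VS c b : V b -> V (perturb y c b).
  by move=> Vb; rewrite /perturb addrC; apply: VL => //; exact: yV.
pose D (r : R) := forall (c : R[i]), complex.Re c ^+ 2 + complex.Im c ^+ 2 <= r ->
  forall b, V b -> nrm (perturb y c b) <= nrm b.
have sign (u : R) : exists2 e : R[i], e = 1 \/ e = -1 & u%:C = `|u|%:C * e.
  case: (leP 0 u) => u0; [exists 1; first by left|exists (-1); first by right].
    by rewrite mulr1 ger0_norm.
  by rewrite mulrN1 ltr0_norm// rmorphN opprK.
(* On this disc |Re c| + |Im c| <= 1, so 1 + c y is a convex combination of 1, one of 1 +- y and one
   of 1 +- i y. *)
have D0 : D (4^-1).
  move=> [s t] /= st b Vb.
  have st1 : `|s| + `|t| <= 1.
    have := normr_ge0 s; have := normr_ge0 t.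
    have := sqr_ge0 (`|s| - `|t|); rewrite -(real_normK (num_real s)) in st.
    rewrite -(real_normK (num_real t)) in st; nra.
  have [es es1 esE] := sign s; have [et et1 etE] := sign t.
  have Hs : nrm (b + es *: (y ** b)) <= nrm b.
    by case: es1 => ->; rewrite ?scale1r ?scaleN1r; [apply: yp|apply: ym].
  have Ht : nrm (b + (et * 'i) *: (y ** b)) <= nrm b.
    case: et1 => ->; rewrite ?mul1r ?mulN1r; apply: skew => //.
    - exact: conj_i_skew.
    - exact: i_sq.
    - by rewrite rmorphN/= conj_i_skew.
    - by rewrite mulrNN i_sq.
  have -> : perturb y (s +i* t) b = (1 - `|s| - `|t|)%:C *: b
      + `|s|%:C *: (b + es *: (y ** b)) + `|t|%:C *: (b + (et * 'i) *: (y ** b)).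
    have -> : s +i* t = `|s|%:C * es + `|t|%:C * et * 'i.
      rewrite -esE -etE; apply/eqP; rewrite eq_complex/=.
      by apply/andP; split; apply/eqP; ring.
    rewrite /perturb !rmorphB rmorph1 /=; linear_ring.
  apply: (le_trans (ler_nrmD _ _)); apply: (le_trans (lerD (ler_nrmD _ _) (lexx _))).
  rewrite !nrmZR !normr_id [`|1 - _ - _|]ger0_norm; last lra.
  have := normr_ge0 s; have := normr_ge0 t; have := nrm_ge0 b; nra.
(* Averaging the squares of [1 + l (1 + i) y] and [1 + l (1 - i) y] cancels
   the terms in [y^2] and leaves [1 + 2 l y]. *)
have D2 r : D r -> D (r *+ 2).
  move=> Dr [u v] /= uvr b Vb.
  pose c1 := ((u - v) / 2) +i* ((u + v) / 2).
  pose c2 := ((u + v) / 2) +i* ((v - u) / 2).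
  have hc1 : complex.Re c1 ^+ 2 + complex.Im c1 ^+ 2 <= r by rewrite /=; nra.
  have hc2 : complex.Re c2 ^+ 2 + complex.Im c2 ^+ 2 <= r by rewrite /=; nra.
  set c := _ +i* _ in uvr *; rewrite -[perturb y c b]half_dbl nrm_half.
  have -> : perturb y c b + perturb y c b =
      perturb y c1 (perturb y c1 b) + perturb y c2 (perturb y c2 b).
    rewrite /perturb !(cmulDr, cmulZr) !scalerDr !scalerA.
    have cE : c + c = (c1 + c1) + (c2 + c2).
      apply/eqP; rewrite eq_complex/=.
      by apply/andP; split; apply/eqP; field.
    have -> : c1 * c1 = - (c2 * c2).
      apply/eqP; rewrite eq_complex/=.
      by apply/andP; split; apply/eqP; field.
    transitivity (b + b + (c + c) *: (y ** b)); first linear_ring.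
    rewrite cE; linear_ring.
  have := ler_nrmD (perturb y c1 (perturb y c1 b)) (perturb y c2 (perturb y c2 b)).
  have := Dr _ hc1 _ (VS c1 _ Vb); have := Dr _ hc1 _ Vb.
  have := Dr _ hc2 _ (VS c2 _ Vb); have := Dr _ hc2 _ Vb; lra.
have Dn n : D (4^-1 *+ (2 ^ n)).
  elim: n => [|n IH]; first by rewrite mulr1n.
  by rewrite expnSr mulrnA; apply: D2.
move=> b Vb; apply: nrm_le0; rewrite leNgt; apply/negP => yb0.
(* With this u the norm of u y b is 2 |b| + 1, above the bound 2 |b| that contractivity of 1 + u y
   imposes. *)
pose u := (2 * nrm b + 1) / nrm (y ** b).
pose n := Num.bound (4 * u ^+ 2).
have /Dn/(_ _ Vb) : complex.Re u%:C ^+ 2 + complex.Im u%:C ^+ 2 <= 4^-1 *+ (2 ^ n).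
  have := archi_boundP (mulr_ge0 (ler0n R 4) (sqr_ge0 u)); rewrite -/n => un.
  have nn : n%:R <= (2 ^ n)%:R :> R by rewrite ler_nat ltnW// ltn_expl.
  rewrite /= -mulr_natr; nra.
rewrite /perturb => hb.
have : nrm (u%:C *: (y ** b)) <= nrm b + nrm b.
  rewrite -[X in nrm X](addKr b) addrC (le_trans (ler_nrmB _ _))// lerD//.
rewrite nrmZR ger0_norm; last by rewrite divr_ge0 ?nrm_ge0// addr_ge0 ?mulr_ge0 ?nrm_ge0.
rewrite /u divfK ?gt_eqF//; lra.
Qed.

(** Contractivity of 1 - h_i replaces positivity. For y = h_i / N, the vanishing sum turns 1 + y
    into the average of 1 and the other 1 - h_j, while 1 - y is a convex combination of 1 and 1 -
    h_i; so both are contractive on [V]. *)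
Lemma sum_contractive_eq0 (I : eqType) (r : seq I) (h : I -> A) V :
  linear_subspace V -> (forall i b, i \in r -> V b -> V (h i ** b)) ->
  (forall i, i \in r -> selfadjoint (h i)) ->
  (forall i b, i \in r -> V b -> nrm (b - h i ** b) <= nrm b) ->
  (forall b, V b -> \sum_(i <- r) h i ** b = 0) ->
  forall i b, i \in r -> V b -> h i ** b = 0.
Proof.
move=> VL hV hs hc h0 i b ir Vb.
pose N := (size r)%:R : R.
have N1 : 1 <= N by rewrite /N ler1n; case: (r) ir.
have N0 : 0 < N by rewrite (lt_le_trans ltr01).
pose y := N^-1%:C *: h i.
suff : y ** b = 0.
  move/(congr1 (fun x => N%:C *: x)); rewrite scaler0 /y cmulZl scalerA.
  by rewrite -rmorphM mulfV ?gt_eqF// rmorph1 scale1r.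
apply: (@contractive_both_eq0 V) => // {b Vb}.
- move=> b Vb; rewrite /y cmulZl -[_ *: _]addr0; case: (VL) => V0 VZ.
  by apply: VZ => //; apply: hV.
- by rewrite /y /selfadjoint cstarZ conj_real hs.
- move=> b Vb.
  have sr : size r = (size (rem i r)).+1 by rewrite size_rem// prednK//; case: (r) ir.
  have -> : b + y ** b = N^-1%:C *: (b + \sum_(j <- rem i r) (b - h j ** b)).
    rewrite big_split/= sumrN big_const_seq count_predT iter_addr_0 addrA -mulrS -sr.
    have := h0 _ Vb; rewrite (perm_big _ (perm_to_rem ir)) big_cons/= => /eqP.
    rewrite addr_eq0 => /eqP <-.
    rewrite scalerDr -scaler_nat scalerA /y cmulZl; congr (_ + _).
    rewrite -[X in _ * X](rmorph_nat (@real_complex R)) -rmorphM /= mulVf ?gt_eqF//.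
    by rewrite scale1r.
  rewrite nrmZR ger0_norm ?invr_ge0 ?(ltW N0)// mulrC ler_pdivrMr//.
  apply: (le_trans (ler_nrmD _ _)); rewrite /N sr mulrS mulrDr mulr1 lerD2l.
  apply: (le_trans (nrm_sum _ _ _)).
  rewrite mulr_natr -iter_addr_0 -(count_predT (rem i r)) -big_const_seq.
  rewrite big_seq [leRHS]big_seq; apply: ler_sum => j /mem_rem jr; exact: hc.
- move=> b Vb; have := hc _ _ ir Vb.
  have -> : b - y ** b = (1 - N^-1)%:C *: b + N^-1%:C *: (b - h i ** b).
    rewrite /y cmulZl rmorphB rmorph1; linear_ring.
  have N10 : 0 <= N^-1 by rewrite invr_ge0 ltW.
  have N11 : N^-1 <= 1 by rewrite invf_le1.
  move=> hb; apply: (le_trans (ler_nrmD _ _)); rewrite !nrmZR !ger0_norm ?subr_ge0//.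
  have := nrm_ge0 b; nra.
Qed.



End Positivity.

(** * Cuntz-Krieger families *)

Section Projections.
Variables (R : realType) (A : cstarAlgType R).
Implicit Types (q b : A).

Lemma projection_contractive q b : projection q -> nrm (q ** b) <= nrm b.
Proof.
move=> [qq qs]; have [->|qb] := eqVneq (nrm (q ** b)) 0; first exact: nrm_ge0.
have qb0 : 0 < nrm (q ** b) by rewrite lt_neqAle eq_sym qb nrm_ge0.
rewrite -(ler_pM2r qb0) -expr2 -nrm_star_cmul cstarM qs.
have -> : b^# ** q ** (q ** b) = b^# ** (q ** b) by rewrite cmulA -(cmulA _ q q) qq cmulA.
by rewrite (le_trans (nrm_cmul _ _))// nrm_star.
Qed.

Lemma projection_compl_contractive q b : projection q -> nrm (b - q ** b) <= nrm b.
Proof.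
move=> [qq qs]; set c := b - q ** b.
have [->|cn] := eqVneq (nrm c) 0; first exact: nrm_ge0.
have c0 : 0 < nrm c by rewrite lt_neqAle eq_sym cn nrm_ge0.
rewrite -(ler_pM2r c0) -expr2 -nrm_star_cmul.
have qc : q ** c = 0 by rewrite cmulBr cmulA qq subrr.
rewrite {1}/c cstarB cstarM qs cmulBl -cmulA qc cmul0r subr0.
by rewrite (le_trans (nrm_cmul _ _))// nrm_star.
Qed.

Variables (I : eqType) (r : seq I) (P : I -> A) (q : A).
Hypotheses (qP : projection q) (PP : forall i, i \in r -> projection (P i)).
Hypothesis qE : q = \sum_(i <- r) P i.

(** On the [b] with q b = 0 the compressions (1 - q) P_j (1 - q) sum to zero, so each vanishes
    there. The i-th one is a* a with a = P_i (1 - q); applied to a* it gives a* a a* = 0, hence a =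
    0. *)
Lemma projection_sum_ge i : i \in r -> q ** P i = P i.
Proof.
move=> ir; have [qq qs] := qP; have [PPi Ps] := PP ir.
pose V := [set b : A | q ** b = 0].
have qV a : q ** (a - q ** a) = 0 by rewrite cmulBr cmulA qq subrr.
pose a := P i - P i ** q.
have aS : a^# = P i - q ** P i by rewrite /a cstarB cstarM Ps qs.
pose h j := (P j - q ** P j) - (P j - q ** P j) ** q.
have hb j b : V b -> h j ** b = P j ** b - q ** (P j ** b).
  rewrite /V/= => Vb; rewrite /h cmulBl -cmulA Vb cmul0r subr0 cmulBl.
  by rewrite cmulA.
have h0 : h i ** a^# = 0.
  apply: (@sum_contractive_eq0 _ _ _ r h V) => //.
  - split=> [|c x y]; first by rewrite /V/= cmul0r.
    by rewrite /V/= cmulDr cmulZr => -> ->; rewrite scaler0 addr0.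
  - by move=> j b jr Vb; rewrite hb// /V/= qV.
  - move=> j /PP[_ Pj]; rewrite /selfadjoint /h !(cstarB, cstarM) Pj qs.
    rewrite !(cmulBr, cmulBl) !cmulA; linear_ring.
  - move=> j b jr Vb; rewrite hb//.
    have -> : b - (P j ** b - q ** (P j ** b)) =
        (b - P j ** b) - q ** (b - P j ** b).
      by rewrite !cmulBr [q ** b]Vb; linear_ring.
    rewrite (le_trans (projection_compl_contractive _ qP))//.
    exact/projection_compl_contractive/PP.
  - move=> b Vb; under eq_bigr do rewrite hb//.
    rewrite sumrB -cmul_sumr -cmul_suml -qE [q ** b]Vb cmul0r subrr//.
  - by rewrite /V/= aS qV.
have hi : h i = a^# ** a.
  rewrite aS /a /h !(cmulBr, cmulBl) !cmulA PPi -!(cmulA _ (P i) (P i)) PPi.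
  by linear_ring.
have : a ** a^# = 0.
  apply: cstar_cmul_eq0; rewrite cstarM cstarK.
  by rewrite -cmulA (cmulA a^#) -hi h0 cmul0r.
rewrite -{1}(cstarK a) => /cstar_cmul_eq0; rewrite aS => /eqP.
by rewrite subr_eq0 => /eqP.
Qed.

(** As P_i lies below q, the compressions P_i P_k P_i over the remaining k sum to P_i (q - P_i) P_i
    = 0, so each vanishes on the range of P_i. *)
Lemma projection_sum_orth i j : uniq r -> i \in r -> j \in r -> i != j ->
  P i ** P j = 0.
Proof.
move=> ur ir jr ij; have [PPi Pis] := PP ir.
pose V := [set b : A | P i ** b = b].
pose h k := P i ** P k ** P i.
have PV b : V b -> forall k, h k ** b = P i ** (P k ** b).
  by move=> Vb k; rewrite /h -!cmulA Vb.
have : h j ** P i = 0.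
  apply: (@sum_contractive_eq0 _ _ _ (rem i r) h V).
  - split=> [|c x y]; first by rewrite /V/= cmul0r.
    by rewrite /V/= cmulDr cmulZr => -> ->.
  - by move=> k b _ Vb; rewrite PV// /V/= cmulA PPi.
  - move=> k /mem_rem/PP[_ Pk].
    by rewrite /selfadjoint /h !cstarM Pk Pis cmulA.
  - move=> k b /mem_rem/PP Pk Vb; rewrite PV//.
    rewrite -{1}[b]Vb -cmulBr (le_trans (projection_contractive _ (PP ir)))//.
    exact: projection_compl_contractive.
  - move=> b Vb; under eq_bigr do rewrite PV//.
    rewrite -cmul_sumr -cmul_suml.
    have -> : \sum_(k <- rem i r) P k = q - P i.
      by rewrite qE (perm_big _ (perm_to_rem ir)) big_cons addrC addrA addNr add0r.
    by rewrite cmulBl cmulBr !cmulA PPi -[P i ** q]cstarK cstarM Pis (qP.2)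
      projection_sum_ge// Pis subrr.
  - by rewrite mem_rem_uniq// inE eq_sym ij.
  - exact: PPi.
rewrite /h -cmulA PPi => PPP; rewrite -[P i ** P j]cstarK.
suff -> : (P i ** P j)^# = 0 by rewrite cstar0.
have [PPj Pjs] := PP jr.
apply: cstar_cmul_eq0; rewrite cstarK cstarM Pis Pjs cmulA.
by rewrite -(cmulA _ (P j) (P j)) PPj.
Qed.

End Projections.

Section CuntzKrieger.
Variables (R : realType) (E : digraph) (A : cstarAlgType R).
Variables (s : edge E -> A) (p : vertex E -> A).
Hypotheses (Erf : row_finite E) (CK : CK_family s p).

Lemma ck_proj v : projection (p v).
Proof. by have [[]] := CK. Qed.

Lemma ck_idem v : p v ** p v = p v.
Proof. by have [] := ck_proj v. Qed.

Lemma ck_selfadj v : (p v)^# = p v.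
Proof. by have [] := ck_proj v. Qed.

Lemma ck_vertex_orth v w : v <> w -> p v ** p w = 0.
Proof. by have [[_ h] _ _ _] := CK; apply: h. Qed.

Lemma ck_starK e : (s e)^# ** s e = p (src e).
Proof. by have [_ _ h _] := CK. Qed.

Lemma ck_partial e : s e ** (s e)^# ** s e = s e.
Proof. by have [_ h _ _] := CK; apply: h. Qed.

Lemma ck_src e : s e ** p (src e) = s e.
Proof. by rewrite -ck_starK cmulA ck_partial. Qed.

Lemma ck_src_star e : p (src e) ** (s e)^# = (s e)^#.
Proof. by rewrite -{1}ck_selfadj -cstarM ck_src. Qed.

Definition in_edges (v : vertex E) : seq (edge E) :=
  finmap.enum_fset (fset_set [set e : edge E | rng e = v]).

Lemma mem_in_edges v e : (e \in in_edges v) = (rng e == v).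
Proof.
rewrite in_fset_set//; apply/idP/eqP; first by rewrite inE.
by move=> h; rewrite inE.
Qed.

Lemma in_edges_uniq v : uniq (in_edges v). Proof. exact: finmap.fset_uniq. Qed.

Lemma ck_sum e : p (rng e) = \sum_(f <- in_edges (rng e)) s f ** (s f)^#.
Proof.
have [_ _ _ h] := CK; rewrite (h (rng e)); last by exists e.
by rewrite fsbig_finite.
Qed.

Lemma range_projection e : projection (s e ** (s e)^#).
Proof.
split; last by rewrite cstarM cstarK.
by rewrite cmulA ck_partial.
Qed.

(** The range projection of [e] is one summand of p_(rng e), hence lies below it. *)
Lemma ck_rng e : p (rng e) ** s e = s e.
Proof.
rewrite -{1}(ck_partial e) cmulA.
rewrite (projection_sum_ge (ck_proj _) _ (ck_sum e)) ?ck_partial//.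
  by move=> f _; exact: range_projection.
by rewrite mem_in_edges.
Qed.

Lemma ck_rng_star e : (s e)^# ** p (rng e) = (s e)^#.
Proof. by rewrite -{1}ck_selfadj -cstarM ck_rng. Qed.

Lemma ck_rng_neq e v : v <> rng e -> p v ** s e = 0.
Proof. by move=> h; rewrite -ck_rng cmulA ck_vertex_orth// cmul0l. Qed.

Lemma ck_orth e f : e <> f -> (s e)^# ** s f = 0.
Proof.
move=> ef; have [rr|rr] := eqVneq (rng e) (rng f); last first.
  rewrite -ck_rng_star -cmulA ck_rng_neq ?cmul0r//; exact/eqP.
have := projection_sum_orth (ck_proj _) _ (ck_sum e) (i := e) (j := f).
move=> /(_ (fun g _ => range_projection g) (in_edges_uniq _)).
rewrite !mem_in_edges eqxx -rr eqxx => /(_ isT isT)/(_ (introN eqP ef)).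
move=> /(congr1 (fun x => (s e)^# ** x ** s f)); rewrite cmul0r cmul0l.
rewrite !cmulA ck_starK ck_src_star -!cmulA ck_starK ck_src//.
Qed.

End CuntzKrieger.

(** * Averaging over the circle *)

Section Isolate.
Variables (R : realType) (A : cstarAlgType R).

Lemma unimodular_root_of_m1 (k : int) : k != 0 ->
  exists2 z : R[i], `|z| = 1 & z ^ k = -1.
Proof.
suff H n : exists2 z : R[i], `|z| = 1 & z ^+ n.+1 = -1.
  case: k => [[|n]//|n] _; first exact: H.
  have [z z1 zn] := H n; exists z => //.
  by rewrite NegzE -exprnN zn invrN invr1.
exists (n.+1.-root (-1)); last by rewrite rootCK.
apply/eqP; rewrite -(@pexpr_eq1 _ _ n.+1)//.
by rewrite -normrX rootCK// normrN normr1.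
Qed.

(* Averaging over [z] and [z0 * z] with [z0 ^ k = -1] removes the terms of
   degree [k] and leaves the constant term. *)
Lemma isolate_constant_term (P : A -> Prop) (I : Type) (r : seq I)
    (k : I -> int) (X : I -> A) :
  (forall x y, P x -> P y -> P (2^-1 *: (x + y))) ->
  (forall z : R[i], `|z| = 1 -> P (\sum_(i <- r) z ^ k i *: X i)) ->
  P (\sum_(i <- r | k i == 0) X i).
Proof.
move=> P2.
(* The accumulator [a] holds the terms of degree zero already met, which averaging leaves fixed. *)
suff H a : (forall z : R[i], `|z| = 1 -> P (a + \sum_(i <- r) z ^ k i *: X i)) ->
    P (a + \sum_(i <- r | k i == 0) X i).
  by move=> h; rewrite -[_ _ r _]add0r; apply: H => z /h; rewrite add0r.
elim: r X a => [|i r IH] X a h.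
  by have := h 1 (normr1 _); rewrite !big_nil.
rewrite big_cons; have [ki|ki] := eqVneq (k i) 0.
  rewrite addrA; apply: IH => z /h; rewrite big_cons ki expr0z scale1r.
  by rewrite addrA.
have [z0 z01 z0k] := unimodular_root_of_m1 ki.
(* Averaging also rescales the terms still to come, so the induction lets [X] vary; in degree zero
   the factor is 1. *)
pose Y j := ((1 + z0 ^ k j) / 2) *: X j.
have -> : \sum_(j <- r | k j == 0) X j = \sum_(j <- r | k j == 0) Y j.
  apply: eq_bigr => j /eqP kj; rewrite /Y kj expr0z -{1}[X j]half_dbl.
  by rewrite scalerDr -scalerDl mulrDl !mul1r.
apply: IH => z z1.
have := P2 _ _ (h z z1) (h (z * z0) _).
rewrite normrM z1 z01 mulr1 => /(_ erefl).
rewrite !big_cons addrACA scalerDr half_dbl; congr (P (a + _)).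
have -> : z ^ k i *: X i + \sum_(j <- r) z ^ k j *: X j +
  ((z * z0) ^ k i *: X i + \sum_(j <- r) (z * z0) ^ k j *: X j) =
  \sum_(j <- r) z ^ k j *: X j + \sum_(j <- r) (z * z0) ^ k j *: X j.
  by rewrite expfzMl z0k mulrN1 scaleNr addrACA subrr add0r.
rewrite -big_split/= scaler_sumr; apply: eq_bigr => j _.
by rewrite expfzMl -scalerDl !scalerA; congr (_ *: _); field.
Qed.

End Isolate.

(** * Cycles without entries in the quotient *)

Section ReturnPath.
Variables (R : realType) (E : digraph) (A : cstarAlgType R).
Variables (s : edge E -> A) (p : vertex E -> A).
Hypotheses (Erf : row_finite E) (CK : CK_family s p).
Variables (gam : R[i] -> A -> A) (J : set A).
Hypotheses (gamP : gauge_action s p gam) (Jgam : gauge_invariant gam J).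
Hypothesis (Jreg : regular_ideal J).
Local Notation I := (perp J).

Variables (a : nat -> edge E) (n : nat).
Local Notation v k := (rng (a k)).
Hypothesis a_path : forall k, src (a k) = v k.+1.
Hypothesis n_gt0 : (0 < n)%N.
Hypothesis a_periodic : forall k, a (k + n)%N = a k.
Hypothesis a_entries : forall k f, rng f = v k -> f <> a k -> J (s f).
Hypothesis a_notin : forall k, ~ J (p (v k)).

Lemma ideal_mull x y : J y -> J (x ** y).
Proof. by have [[_ _ h] _] := Jreg => /(h x)[]. Qed.

Lemma ideal_mulr x y : J x -> J (x ** y).
Proof. by have [[_ _ h] _] := Jreg => /(h y)[]. Qed.

Lemma perp_mull x y : I y -> I (x ** y).
Proof.
move=> Iy b Jb; rewrite -cmulA (Iy _ Jb).1 cmul0r cmulA.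
by rewrite (Iy _ (ideal_mulr x Jb)).2.
Qed.

Lemma perp_mulr x y : I x -> I (x ** y).
Proof.
move=> Ix b Jb; rewrite -cmulA (Ix _ (ideal_mull y Jb)).1.
by rewrite cmulA (Ix _ Jb).2 cmul0l.
Qed.

Lemma perpD x y : I x -> I y -> I (x + y).
Proof.
move=> Ix Iy b Jb; rewrite cmulDl cmulDr (Ix _ Jb).1 (Ix _ Jb).2.
by rewrite (Iy _ Jb).1 (Iy _ Jb).2 addr0.
Qed.

Lemma perpZ (c : R[i]) x : I x -> I (c *: x).
Proof. by move=> Ix b Jb; rewrite cmulZl cmulZr (Ix _ Jb).1 (Ix _ Jb).2 scaler0. Qed.

Lemma perp_gauge z x : `|z| = 1 -> I x -> I (gam z x).
Proof.
move=> z1 Ix b; have [gH _ _ _ _] := gamP; have gz := gH _ z1.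
rewrite -(Jgam z1) => -[c Jc <-]; have [_ gM _] := gz.
by rewrite -!gM (Ix _ Jc).1 (Ix _ Jc).2 star_hom0.
Qed.

(** The identity s_f* = s_f* s_f s_f* exhibits s_f as a factor of its adjoint. *)
Lemma ideal_star_edge f : J (s f) -> J (s f)^#.
Proof.
move=> Jf; rewrite -(ck_src_star CK) -(ck_starK CK).
by apply: ideal_mulr; apply: ideal_mull.
Qed.

(** Otherwise [a 0] would be a foreign edge into [v i], putting s_(a 0), and with it the projection
    of [v 1], into [J]. *)
Lemma return_step i : v i = v 0 -> a i = a 0.
Proof.
move=> vi; apply/eqP/negPn/negP => /eqP ai.
have : J (s (a 0)) by apply: (@a_entries i) => // /esym.
move=> /(ideal_mull (s (a 0))^#); rewrite (ck_starK CK) a_path.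
exact: a_notin.
Qed.

Fixpoint trail m k : A :=
  if k is k'.+1 then s (a m) ** trail m.+1 k' else p (v m).

Lemma trail_rng m k : p (v m) ** trail m k = trail m k.
Proof. by case: k => [|k] /=; rewrite ?(ck_idem CK)// cmulA (ck_rng Erf CK). Qed.

Lemma trailD m k l : trail m (k + l) = trail m k ** trail (m + k) l.
Proof.
elim: k m => [|k IH] m; first by rewrite addn0 /= trail_rng.
by rewrite addSn /= IH cmulA addSnnS.
Qed.

Lemma trail_src m k : trail m k ** p (v (m + k)) = trail m k.
Proof. by rewrite -[in RHS](addn0 k) trailD. Qed.

Lemma trail_starK m k : (trail m k)^# ** trail m k = p (v (m + k)).
Proof.
elim: k m => [|k IH] m /=; first by rewrite addn0 (ck_selfadj CK) (ck_idem CK).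
rewrite cstarM cmulA -(cmulA _ (s _)^#) (ck_starK CK) a_path -cmulA trail_rng IH.
by rewrite addSnnS.
Qed.

Lemma trail_contractive m k x : nrm (trail m k ** x) <= nrm x.
Proof.
rewrite -(ler_pXn2r (n := 2)) ?nnegrE ?nrm_ge0// -nrm_star_cmul cstarM.
rewrite cmulA -(cmulA _ _ (trail m k)) trail_starK -cmulA.
rewrite (le_trans (nrm_cmul _ _))// nrm_star expr2 ler_wpM2l ?nrm_ge0//.
exact: (projection_contractive _ (ck_proj CK _)).
Qed.

Lemma nrm_trail m k : nrm (trail m k) <= 1.
Proof.
have := trail_contractive m k (p (v (m + k))); rewrite trail_src.
suff : nrm (p (v (m + k))) <= 1 by move=> /[swap]; exact: le_trans.
have := nrm_star_cmul (p (v (m + k))); rewrite (ck_selfadj CK) (ck_idem CK).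
have := nrm_ge0 (p (v (m + k))); nra.
Qed.

Lemma trail_star_contractive m k x : nrm ((trail m k)^# ** x) <= nrm x.
Proof.
rewrite (le_trans (nrm_cmul _ _))// nrm_star.
by rewrite ler_piMl ?nrm_ge0// nrm_trail.
Qed.

Lemma mulr_trail_contractive m k x : nrm (x ** trail m k) <= nrm x.
Proof. by rewrite (le_trans (nrm_cmul _ _))// ler_piMr ?nrm_ge0// nrm_trail. Qed.

(** The summands of p_(v m) for edges other than [a m] lie in J and annihilate [z]; hence s_(a m)
    maps I onto p_(v m) I, which is what makes a turn of the cycle unitary there. *)
Lemma perp_edge_sum m z : I z ->
  p (v m) ** z = s (a m) ** ((s (a m))^# ** z).
Proof.
move=> Iz; rewrite (ck_sum Erf CK) cmul_suml.
have am : a m \in in_edges (v m) by rewrite (mem_in_edges Erf).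
rewrite (big_rem _ am)/= big_seq big1 ?addr0 ?cmulA// => f.
rewrite (mem_rem_uniq) ?in_edges_uniq// inE (mem_in_edges Erf) => /andP[/eqP fa /eqP fv].
by rewrite -cmulA (Iz _ (ideal_star_edge (a_entries fv fa))).2 cmul0r.
Qed.

Lemma perp_sum_edge m z : I z ->
  z ** p (v m) = (z ** s (a m)) ** (s (a m))^#.
Proof.
move=> Iz; rewrite (ck_sum Erf CK) cmul_sumr.
have am : a m \in in_edges (v m) by rewrite (mem_in_edges Erf).
rewrite (big_rem _ am)/= big_seq big1 ?addr0 ?cmulA// => f.
rewrite (mem_rem_uniq) ?in_edges_uniq// inE (mem_in_edges Erf) => /andP[/eqP fa /eqP fv].
by rewrite cmulA (Iz _ (a_entries fv fa)).1 cmul0l.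
Qed.

Lemma perp_trailK m k z : I z -> trail m k ** ((trail m k)^# ** z) = p (v m) ** z.
Proof.
elim: k m z => [|k IH] m z Iz /=.
  by rewrite (ck_selfadj CK) cmulA (ck_idem CK).
rewrite perp_edge_sum// -cmulA; congr (_ ** _).
rewrite cstarM -cmulA IH; last exact: perp_mull.
by rewrite -a_path cmulA (ck_src_star CK).
Qed.

Lemma perp_Ktrail m k z : I z -> (z ** trail m k) ** (trail m k)^# = z ** p (v m).
Proof.
elim: k m z => [|k IH] m z Iz /=.
  by rewrite (ck_selfadj CK) -cmulA (ck_idem CK).
rewrite perp_sum_edge// cstarM cmulA; congr (_ ** _).
rewrite (cmulA z) IH; last exact: perp_mulr.
by rewrite -cmulA -a_path (ck_src CK).
Qed.

Lemma gauge_star z x : `|z| = 1 -> gam z x^# = (gam z x)^#.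
Proof. by move=> z1; have [/(_ _ z1)[]] := gamP. Qed.

Lemma gauge_trail z m k : `|z| = 1 -> gam z (trail m k) = z ^+ k *: trail m k.
Proof.
move=> z1; have [/(_ _ z1)[_ gM _] _ _ gs gp] := gamP.
elim: k m => [|k IH] m /=; first by rewrite expr0 scale1r gp.
by rewrite gM gs// IH cmulZl cmulZr scalerA exprS.
Qed.

(* Since [a] is determined by its first vertex, the trail starts over at each
   return to it. *)
Definition ret i := v i == v 0.
Local Notation P := (p (v 0)).
Local Notation T := (trail 0).

Lemma ret_shift i k : ret i -> a (i + k)%N = a k.
Proof.
move=> /eqP vi; elim: k => [|k IH]; first by rewrite addn0 return_step.
apply/eqP/negPn/negP => /eqP aik.
have vk : v (i + k.+1) = v k.+1 by rewrite addnS -!a_path IH.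
have : J (s (a k.+1)) by apply: (@a_entries (i + k.+1)) => // /esym.
move=> /(ideal_mull (s (a k.+1))^#); rewrite (ck_starK CK) a_path.
exact: a_notin.
Qed.

Lemma ret_trail i k l : ret i -> trail (i + k) l = trail k l.
Proof.
move=> ri; elim: l k => [|l IH] k /=; first by rewrite ret_shift.
by rewrite ret_shift// -addnS IH.
Qed.

Lemma retD i j : ret i -> ret (i + j) = ret j.
Proof. by move=> ri; rewrite /ret ret_shift. Qed.

Lemma ret_period k : ret (k * n).
Proof.
elim: k => [|k IH]; first exact: eqxx.
by rewrite mulSn addnC /ret a_periodic.
Qed.

Lemma TD i k : ret i -> T (i + k) = T i ** T k.
Proof. by move=> ri; rewrite trailD -(ret_trail 0 k ri) addn0 add0n. Qed.

Lemma T_comm i k : ret i -> ret k -> T i ** T k = T k ** T i.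
Proof. by move=> ri rk; rewrite -!TD// addnC. Qed.

Lemma T_starK i : ret i -> (T i)^# ** T i = P.
Proof. by move=> /eqP ri; rewrite trail_starK add0n ri. Qed.

Lemma T_starD i d : ret i -> (T i)^# ** T (i + d) = T d.
Proof. by move=> ri; rewrite TD// cmulA T_starK// trail_rng. Qed.

Lemma T_Dstar i d : ret i -> (T (i + d))^# ** T i = (T d)^#.
Proof. by move=> ri; rewrite -[T i in LHS]cstarK -cstarM T_starD. Qed.

Lemma PT i : P ** T i = T i. Proof. exact: trail_rng. Qed.

Lemma TP i : ret i -> T i ** P = T i.
Proof. by move=> /eqP ri; rewrite -[RHS](trail_src 0 i) add0n ri. Qed.

Lemma T_not_ret i k : ~~ ret i -> T i ** T k = 0.
Proof.
move=> /eqP ri; rewrite -(trail_src 0 i) -(PT k) cmulA -(cmulA (T i)).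
by rewrite (ck_vertex_orth CK)// cmul0r cmul0l.
Qed.

Lemma P_starT i : ret i -> P ** (T i)^# = (T i)^#.
Proof. by move=> ri; rewrite -{1}(ck_selfadj CK) -cstarM TP. Qed.

(** * Laurent polynomials in one turn of the cycle *)

Definition corner z := I z /\ P ** z = z.

Lemma corner_T z i : ret i -> corner z -> corner (T i ** z).
Proof.
move=> ri [Iz Pz]; split; first exact: perp_mull.
by rewrite cmulA PT.
Qed.

Lemma cornerK z i : corner z -> T i ** ((T i)^# ** z) = z.
Proof. by move=> [Iz Pz]; rewrite perp_trailK. Qed.

Lemma corner_starK z i : ret i -> corner z -> (T i)^# ** (T i ** z) = z.
Proof. by move=> ri [Iz Pz]; rewrite cmulA T_starK. Qed.

(* On [corner], [T i] acts for each return [i] as a power of the unitary of the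
   first turn: [span m] consists of the Laurent polynomials of degree at most
   [m] in it, written with isometries. *)
Definition span m (F : A) := exists c : nat -> R[i],
  F = \sum_(0 <= i < (m.*2).+1 | ret i) c i *: ((T m)^# ** T i).

Lemma span0 m : span m 0.
Proof. by exists (fun=> 0); rewrite big1// => i _; rewrite scale0r. Qed.

Lemma spanD m F G : span m F -> span m G -> span m (F + G).
Proof.
move=> [c ->] [d ->]; exists (fun i => c i + d i).
by rewrite -big_split/=; apply: eq_bigr => i _; rewrite scalerDl.
Qed.

Lemma spanZ m (e : R[i]) F : span m F -> span m (e *: F).
Proof.
move=> [c ->]; exists (fun i => e * c i).
by rewrite scaler_sumr; apply: eq_bigr => i _; rewrite scalerA.
Qed.

Lemma span_sum m (X : Type) (r : seq X) (Q : pred X) (F : X -> A) :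
  (forall x, Q x -> span m (F x)) -> span m (\sum_(x <- r | Q x) F x).
Proof. by move=> h; elim/big_ind : _ => //; [exact: span0|exact: spanD]. Qed.

Lemma span1 m i : (i <= m.*2)%N -> ret i -> span m ((T m)^# ** T i).
Proof.
move=> im ri; exists (fun j => (j == i)%:R).
rewrite big_mkcond (bigD1_seq i) ?iota_uniq ?mem_index_iota//= ri eqxx scale1r.
by rewrite big1 ?addr0// => j /negPf ->; rewrite scale0r; case: ifP.
Qed.

Lemma span_star m F : ret m -> span m F -> span m F^#.
Proof.
move=> rm [c ->]; rewrite cstar_sum big_seq_cond.
apply: span_sum => i /andP[]; rewrite mem_index_iota ltnS => /andP[_ im] ri.
rewrite cstarZ cstarM cstarK; apply: spanZ.
have rmi : ret (m.*2 - i).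
  by rewrite -(retD _ ri) subnKC// -addnn retD.
(* A term of degree i - m has an adjoint of degree m - i = (2 m - i) - m. *)
suff -> : (T i)^# ** T m = (T m)^# ** T (m.*2 - i).
  by apply: span1 => //; lia.
have [mi|mi] := leqP i m.
  have -> : (m.*2 - i)%N = (m + (m - i))%N by lia.
  by rewrite T_starD// -{1}(subnKC mi) T_starD.
have := T_Dstar (i - m) rm; rewrite subnKC; last exact: ltnW.
move=> ->; have := T_Dstar (i - m) rmi.
by rewrite (_ : _ + _ = m)%N; last lia.
Qed.

(** A bound on the norm of [F] in A/I, carried by a witness. *)
Definition within (C : R) (F : A) := exists2 w, I w & nrm (F - w) <= C.

Lemma within_half C x y : within C x -> within C y ->
  within C (2^-1 *: (x + y)).
Proof.
move=> [w Iw xw] [w' Iw' yw']; exists (2^-1 *: (w + w')).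
  by apply: perpZ; apply: perpD.
rewrite -scalerBr nrm_half opprD addrACA.
have := ler_nrmD (x - w) (y - w'); lra.
Qed.

Lemma within_mul C x y F : (forall z, nrm (x ** z) <= nrm z) ->
  (forall z, nrm (z ** y) <= nrm z) -> within C F -> within C (x ** F ** y).
Proof.
move=> xc yc [w Iw Fw]; exists (x ** w ** y).
  by apply: perp_mulr; apply: perp_mull.
by rewrite -cmulBl -cmulBr (le_trans (yc _))// (le_trans (xc _)).
Qed.

Lemma within_gauge C z F : `|z| = 1 -> within C F -> within C (gam z F).
Proof.
move=> z1 [w Iw Fw]; exists (gam z w); first exact: perp_gauge.
have [/(_ _ z1) gH _ _ _ _] := gamP.
by rewrite -(star_homB gH) (le_trans (star_hom_contractive gH _)).
Qed.

(** For y in J the witness [w] annihilates P y, so |c| |P y| = |(c P - w) P y| <= C |P y|. If |c| >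
    C, then P y = 0, and likewise y P = 0, for all y in J: this is membership of P in I. *)
Lemma within_vertex C (c : R[i]) : 0 <= C -> within C (c *: P) ->
  complex.Re `|c| <= C \/ I P.
Proof.
move=> C0 [w Iw cw]; have [|cC] := leP (complex.Re `|c|) C; first by left.
right; have c0 : c != 0.
  by apply/eqP => c0; move: cC; rewrite c0 normr0/= ltNge C0.
have kill y : J y -> P ** y = 0 /\ y ** P = 0.
  move=> Jy.
  have E1 : c *: (P ** y) = (c *: P - w) ** (P ** y).
    rewrite cmulBl (Iw _ (ideal_mull _ Jy)).1 subr0 cmulZl cmulA.
    by rewrite (ck_idem CK).
  have E2 : c *: (y ** P) = (y ** P) ** (c *: P - w).
    rewrite cmulBr (Iw _ (ideal_mulr _ Jy)).2 subr0 cmulZr -cmulA.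
    by rewrite (ck_idem CK).
  split; apply: nrm_le0; rewrite leNgt; apply/negP.
    have := nrmZ c (P ** y); rewrite E1.
    have := nrm_cmul (c *: P - w) (P ** y); nra.
  have := nrmZ c (y ** P); rewrite E2.
  have := nrm_cmul (y ** P) (c *: P - w); nra.
by move=> y /kill.
Qed.

Hypothesis notIP : ~ I P.

(** Multiplication by (T i)* on the left and T m on the right turns the j-th term into c_j (T i)* T
    j, of gauge degree j - i. The part of degree zero is c_i P, and averaging keeps it within [C] of
    I. *)
Lemma span_coef m C (c : nat -> R[i]) : ret m -> 0 <= C ->
  within C (\sum_(0 <= i < (m.*2).+1 | ret i) c i *: ((T m)^# ** T i)) ->
  forall i, (i <= m.*2)%N -> ret i -> complex.Re `|c i| <= C.
Proof.
move=> rm C0 hC i im ri.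
suff /(within_vertex C0)[//|/notIP[]] : within C (c i *: P).
have {}hC := within_mul (trail_star_contractive 0 i)
  (mulr_trail_contractive 0 m) hC.
set r := [seq j <- index_iota 0 (m.*2).+1 | ret j].
have E1 : (T i)^# ** (\sum_(0 <= j < (m.*2).+1 | ret j)
      c j *: ((T m)^# ** T j)) ** T m = \sum_(j <- r) c j *: ((T i)^# ** T j).
  rewrite cmul_sumr cmul_suml big_filter; apply: eq_bigr => j rj.
  rewrite cmulZr cmulZl -!cmulA (T_comm rj rm) (cmulA (T m)^#) T_starK//.
  by rewrite PT.
rewrite E1 in hC.
have : within C (\sum_(j <- r | (j%:Z - i%:Z == 0)) c j *: ((T i)^# ** T j)).
  apply: isolate_constant_term => [x y|z z1]; first exact: within_half.
  have [/(_ _ z1) gH _ _ _ _] := gamP.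
  have := within_gauge z1 hC; rewrite (star_hom_sum gH).
  under eq_bigr => j _.
    have [_ gM _] := gH; rewrite (star_homZ gH) gM gauge_star// !gauge_trail//.
    rewrite cstarZ cmulZl cmulZr !scalerA.
    have -> : c j * (Num.conj (z ^+ i) * z ^+ j) = z ^ (j%:Z - i%:Z) * c j.
      have z0 : z != 0 by rewrite -normr_eq0 z1 oner_eq0.
      rewrite mulrC; congr (_ * _); rewrite expfzDr// -exprnN mulrC.
      congr (_ * _); rewrite invC_norm normrX z1 !expr1n invr1 mul1r//.
    rewrite -scalerA.
    over.
  by [].
have ir : i \in r by rewrite mem_filter ri mem_index_iota.
rewrite big_mkcond (bigD1_seq i)//=; last by rewrite filter_uniq// iota_uniq.
rewrite subrr eqxx T_starK// big1 ?addr0// => j /negPf ji.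
by rewrite subr_eq0 eqz_nat ji.
Qed.

Lemma span_nrm m F C z : ret m -> 0 <= C -> span m F -> within C F ->
  corner z -> nrm (F ** z) <= (m.*2).+1%:R * C * nrm z.
Proof.
move=> rm C0 [c ->] hC cz.
have cC := span_coef rm C0 hC.
rewrite cmul_suml; apply: (le_trans (nrm_sum _ _ _)).
have -> : (m.*2).+1%:R * C * nrm z = \sum_(0 <= i < (m.*2).+1) C * nrm z.
  by rewrite big_const_nat iter_addr_0 subn0 -[RHS]mulr_natl mulrA.
rewrite big_mkcond/= big_seq [leRHS]big_seq; apply: ler_sum => i.
rewrite mem_index_iota ltnS => /andP[_ im].
case: ifPn => ri; last by rewrite mulr_ge0// nrm_ge0.
rewrite cmulZl nrmZ; apply: ler_pM; rewrite ?nrm_ge0 ?cC//.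
  by rewrite -(lecR 0) RRe_real ?normr_real ?normr_ge0.
rewrite -cmulA (le_trans (trail_star_contractive _ _ _))//.
exact: trail_contractive.
Qed.

Lemma corner_span m F z : ret m -> span m F -> corner z -> corner (F ** z).
Proof.
move=> rm [c ->] cz; split; first by case: cz => Iz _; exact: perp_mull.
rewrite cmulA cmul_sumr; congr (_ ** _); apply: eq_bigr => i ri.
by rewrite cmulZr cmulA P_starT.
Qed.

(* The compression restores the shape of [span], which products do not keep
   since [T m ** (T m)^#] is not [P]. *)
Definition compress_sq m F := (T m)^# ** F ** F ** T m.

Lemma span_compress_sq m F : ret m -> span m F -> span m.*2 (compress_sq m F).
Proof.
move=> rm [c ->]; rewrite /compress_sq -(cmulA (T m)^#) cmul_suml cmul_sumr.
rewrite cmul_suml big_seq_cond.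
apply: span_sum => i /andP[]; rewrite mem_index_iota ltnS => /andP[_ im] ri.
rewrite cmul_sumr cmul_sumr cmul_suml big_seq_cond.
apply: span_sum => j /andP[]; rewrite mem_index_iota ltnS => /andP[_ jm] rj.
rewrite !(cmulZl, cmulZr); do 2!apply: spanZ.
suff -> : (T m)^# ** ((T m)^# ** T i ** ((T m)^# ** T j)) ** T m =
    (T m.*2)^# ** T (i + j).
  by apply: span1; rewrite ?retD//; lia.
rewrite -!cmulA (T_comm rj rm) (cmulA (T m)^# (T m)) T_starK// PT -TD//.
by rewrite -addnn (TD m rm) cstarM -cmulA.
Qed.

(** On the corner [T m] commutes with [F] and is undone by its adjoint. *)
Lemma corner_compress_sq m F z : ret m -> span m F -> corner z ->
  compress_sq m F ** z = F ** (F ** z).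
Proof.
move=> rm sF cz.
have FT y : corner y -> F ** (T m ** y) = T m ** (F ** y).
  move=> cy; case: sF => c ->; rewrite !cmul_suml cmul_sumr.
  apply: eq_bigr => i ri; rewrite !cmulZl cmulZr; congr (_ *: _).
  rewrite -!cmulA cornerK; last exact: corner_T.
  by rewrite (cmulA (T i)) (T_comm ri rm) -cmulA corner_starK//; exact: corner_T.
rewrite /compress_sq -!cmulA FT// FT; last exact: (corner_span rm sF).
rewrite corner_starK//; do 2!apply: (corner_span rm sF).
exact: cz.
Qed.

Lemma within_compress_sq m F C : 0 <= C -> within C F ->
  within (C ^+ 2) (compress_sq m F).
Proof.
move=> C0 [w Iw Fw]; rewrite /compress_sq -(cmulA (T m)^#).
apply: within_mul; [exact: trail_star_contractive|exact: mulr_trail_contractive|].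
(* This is F^2 - (F - w)^2, written so that each term has a factor [w]. *)
exists (w ** F + (F - w) ** w).
  by apply: perpD; [exact: perp_mulr|exact: perp_mull].
have -> : F ** F - (w ** F + (F - w) ** w) = (F - w) ** (F - w).
  rewrite !(cmulBl, cmulBr); linear_ring.
rewrite (le_trans (nrm_cmul _ _))// expr2 ler_pM ?nrm_ge0//.
Qed.

(** Each squaring doubles [m] and squares [C] and [B]; the bound returns to [F] through |F z|^2 =
    |z* F^2 z| <= |z| |F^2 z|. After j squarings the linear factor of [span_nrm] stands under a
    2^j-th root. *)
Lemma span_nrm_pow j m F C B : ret m -> selfadjoint F -> span m F -> 0 <= C ->
  within C F -> 0 <= B ->
  ((2 ^ j * m).*2).+1%:R * C ^+ (2 ^ j) <= B ^+ (2 ^ j) ->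
  forall z, corner z -> nrm (F ** z) <= B * nrm z.
Proof.
elim: j m F C B => [|j IH] m F C B rm sF spF C0 wF B0 h z cz.
  apply: le_trans (span_nrm rm C0 spF wF cz) _.
  by rewrite ler_wpM2r ?nrm_ge0//; move: h; rewrite expn0 mul1n !expr1.
have sG : selfadjoint (compress_sq m F).
  by rewrite /selfadjoint /compress_sq !cstarM cstarK sF !cmulA.
have hG : nrm (F ** (F ** z)) <= B ^+ 2 * nrm z.
  rewrite -(corner_compress_sq rm spF cz).
  apply: (IH m.*2 (compress_sq m F) (C ^+ 2)) => //.
  - by rewrite -addnn retD.
  - exact: span_compress_sq.
  - exact: exprn_ge0.
  - exact: within_compress_sq.
  - exact: exprn_ge0.
  - rewrite -!exprM -expnS.
    by have -> : (2 ^ j * m.*2 = 2 ^ j.+1 * m)%N by rewrite expnSr -mul2n mulnA.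
rewrite -(ler_pXn2r (n := 2)) ?nnegrE ?nrm_ge0 ?mulr_ge0 ?nrm_ge0//.
rewrite -nrm_star_cmul cstarM sF -cmulA.
apply: (le_trans (nrm_cmul _ _)); rewrite nrm_star exprMn [leRHS]mulrC.
rewrite [nrm z ^+ 2]expr2 -mulrA ler_wpM2l ?nrm_ge0// mulrC//.
Qed.

Lemma span_nrm_within m F C z : ret m -> selfadjoint F -> span m F -> 0 <= C ->
  within C F -> corner z -> nrm (F ** z) <= C *+ 2 * nrm z.
Proof.
move=> rm sF spF C0 wF cz.
(* After m + 2 squarings there are 2^(m+3) m + 1 coefficients, at most 2^(2^(m+2)); the doubling of
   [C] absorbs this number. *)
apply: (@span_nrm_pow m.+2 m F C) => //; first by rewrite mulrn_wge0.
rewrite exprMn_n -[leRHS]mulr_natl ler_wpM2r ?exprn_ge0// ler_nat.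
have h k : (k < 2 ^ k)%N by rewrite ltn_expl.
have h1 : ((2 ^ m.+2 * m).*2 < 2 ^ (m.+2 + m).+1)%N.
  by rewrite -mul2n mulnA -expnS -addSn expnD ltn_pmul2l ?expn_gt0.
apply: (leq_trans h1); rewrite leq_exp2l// !expnS; have := h m; lia.
Qed.

(** * Approximation by words in the edges *)

Definition word (l : seq (edge E)) (w : vertex E) : A :=
  foldr (fun e y => s e ** y) (p w) l.

(* With [b] set, only words of positive length are allowed. *)
Definition words (b : bool) (y : A) := exists r : seq (R[i] * seq (edge E) * vertex E),
  (b -> all (fun x => x.1.2 != [::]) r) /\
  y = \sum_(x <- r) x.1.1 *: word x.1.2 x.2.

Lemma wordsW (b : bool) y : words true y -> words b y.
Proof. by move=> [r [h ->]]; exists r; split=> // _; exact: h. Qed.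

Lemma words0 b : words b 0.
Proof. by exists [::]; rewrite big_nil. Qed.

Lemma wordsD b x y : words b x -> words b y -> words b (x + y).
Proof.
move=> [r [hr ->]] [t [ht ->]]; exists (r ++ t); rewrite big_cat; split=> // b1.
by rewrite all_cat hr ?ht.
Qed.

Lemma wordsZ b (c : R[i]) x : words b x -> words b (c *: x).
Proof.
move=> [r [hr ->]]; exists [seq ((c * x.1.1, x.1.2), x.2) | x <- r].
split=> [b1|]; first by rewrite all_map; exact: hr.
by rewrite big_map scaler_sumr; apply: eq_bigr => y _; rewrite scalerA.
Qed.

Lemma words_sum b (X : eqType) (r : seq X) (F : X -> A) :
  (forall x, x \in r -> words b (F x)) -> words b (\sum_(x <- r) F x).
Proof.
move=> h; rewrite big_seq; elim/big_ind : _ => //.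
- exact: words0.
- exact: wordsD.
Qed.

Lemma words1 (b : bool) l w : (b -> l != [::]) -> words b (word l w).
Proof.
move=> h; exists [:: ((1, l), w)]; rewrite big_seq1 scale1r; split=> //= /h.
by move=> ->.
Qed.

Lemma vertex_word u l w :
  p u ** word l w = word l w \/ p u ** word l w = 0.
Proof.
case: l => [|e l] /=.
  have [->|/eqP uw] := eqVneq u w; first by left; rewrite (ck_idem CK).
  by right; rewrite (ck_vertex_orth CK).
rewrite cmulA; have [->|/eqP ue] := eqVneq u (rng e); first by left; rewrite (ck_rng Erf CK).
by right; rewrite (ck_rng_neq Erf CK)// cmul0l.
Qed.

Lemma word_edge l w e : word l w ** s e = word (rcons l e) (src e) \/
  word l w ** s e = 0.
Proof.
elim: l => [|f l IH] /=.
  have [->|/eqP we] := eqVneq w (rng e); [left|right].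
    by rewrite (ck_rng Erf CK) (ck_src CK).
  by rewrite (ck_rng_neq Erf CK).
by case: IH => h; rewrite -cmulA h ?cmul0r; [left|right].
Qed.

Lemma words_edge b y e : words b y -> words true (y ** s e).
Proof.
move=> [r [_ ->]]; rewrite cmul_suml; apply: words_sum => x _.
rewrite cmulZl; apply: wordsZ; case: (word_edge x.1.2 x.2 e) => ->.
  by apply: words1 => _; case: x.1.2.
exact: words0.
Qed.

Lemma edge_words b y e : words b y -> words true (s e ** y).
Proof.
move=> [r [_ ->]]; rewrite cmul_sumr; apply: words_sum => x _.
by rewrite cmulZr; apply: wordsZ; exact: (@words1 _ (e :: x.1.2)).
Qed.

Lemma vertex_words b y u : words b y -> words b (p u ** y).
Proof.
move=> [r [h ->]]; rewrite cmul_sumr; apply: words_sum => x xr.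
rewrite cmulZr; apply: wordsZ; case: (vertex_word u x.1.2 x.2) => ->.
  by apply: words1 => /h/allP/(_ _ xr).
exact: words0.
Qed.

(** An adjoint edge either cancels the first letter or kills the word. A bare vertex projection has
    no letter to cancel, hence the restriction to positive length. *)
Lemma edge_star_words y e : words true y -> words false ((s e)^# ** y).
Proof.
move=> [r [h ->]]; rewrite cmul_sumr; apply: words_sum => x xr.
rewrite cmulZr; apply: wordsZ; have /allP/(_ _ xr) := h isT.
case: x.1.2 => [//|f l] _ /=.
have [<-|/eqP ef] := eqVneq e f; last first.
  by rewrite cmulA (ck_orth Erf CK)// cmul0l; exact: words0.
by rewrite cmulA (ck_starK CK); apply: vertex_words; exact: words1.
Qed.

(** Elements of [A] are approximated by sums of products s_alpha s_beta*; a long enough trail on the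
    right absorbs every s_beta* and leaves words without adjoints. *)
Definition eventually_words y := exists N, words false (y ** T N).

Lemma trailSr N : T N.+1 = T N ** s (a N).
Proof.
by rewrite -addn1 trailD /= add0n -a_path (ck_src CK).
Qed.

Lemma words_trailS b y N : words b (y ** T N) -> words true (y ** T N.+1).
Proof. by rewrite trailSr cmulA; exact: words_edge. Qed.

Lemma words_trail_le b y N M : (N <= M)%N -> words b (y ** T N) ->
  words b (y ** T M).
Proof.
move=> /subnK <-; elim: (M - N)%N => // k IH /IH h.
by apply: wordsW; exact: words_trailS h.
Qed.

Lemma eventually_wordsD x y : eventually_words x -> eventually_words y ->
  eventually_words (x + y).
Proof.
move=> [N hN] [M hM]; exists (maxn N M); rewrite cmulDl.
by apply: wordsD; [apply: words_trail_le hN|apply: words_trail_le hM];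
  rewrite ?leq_maxl ?leq_maxr.
Qed.

Lemma eventually_wordsZ (c : R[i]) x : eventually_words x -> eventually_words (c *: x).
Proof. by move=> [N hN]; exists N; rewrite cmulZl; exact: wordsZ. Qed.

Definition approx_words y :=
  forall e, 0 < e -> exists2 y', eventually_words y' & nrm (y - y') < e.

Lemma approx_wordsD x y : approx_words x -> approx_words y -> approx_words (x + y).
Proof.
move=> hx hy e e0; have e20 : 0 < e / 2 by rewrite divr_gt0.
have [x' hx' xx'] := hx _ e20; have [y' hy' yy'] := hy _ e20.
exists (x' + y'); first exact: eventually_wordsD.
rewrite opprD addrACA; have := ler_nrmD (x - x') (y - y'); lra.
Qed.

Lemma approx_words_mull x y : (forall y', eventually_words y' -> eventually_words (x ** y')) ->
  approx_words y -> approx_words (x ** y).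
Proof.
move=> hx hy e e0; have xp : 0 < nrm x + 1 by rewrite ltr_wpDl ?nrm_ge0.
have [|y' hy' yy'] := hy (e / (nrm x + 1)); first by rewrite divr_gt0.
exists (x ** y'); first exact: hx.
rewrite -cmulBr (le_lt_trans (nrm_cmul _ _))//.
move: yy'; rewrite ltr_pdivlMr//; have := nrm_ge0 (y - y'); nra.
Qed.

Lemma approx_wordsZ (c : R[i]) x : approx_words x -> approx_words (c *: x).
Proof.
move=> hx e e0.
have c0 : 0 <= complex.Re `|c| by rewrite -(lecR 0) RRe_real ?normr_real ?normr_ge0.
have cp : 0 < complex.Re `|c| + 1 by rewrite ltr_wpDl.
have [|x' hx' xx'] := hx (e / (complex.Re `|c| + 1)); first by rewrite divr_gt0.
exists (c *: x'); first exact: eventually_wordsZ.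
rewrite -scalerBr nrmZ.
move: xx'; rewrite ltr_pdivlMr//; have := nrm_ge0 (x - x'); nra.
Qed.

Lemma approx_words_closed : closed [set y | approx_words y].
Proof.
apply/closed_nrmP => y h e e0; have e20 : 0 < e / 2 by rewrite divr_gt0.
have [z hz yz] := h _ e20; have [z' hz' zz'] := hz _ e20.
exists z' => //; have := ler_nrm_trans y z z'; lra.
Qed.

Hypothesis Agen : generates s p.

(* The approximable elements form a closed left ideal: those that multiply it
   into itself form a C*-subalgebra containing the generators. *)
Lemma approx_words_ideal x y : approx_words y -> approx_words (x ** y).
Proof.
pose X := [set x | forall y, approx_words y ->
  approx_words (x ** y) /\ approx_words (x^# ** y)].
suff Xx : X x by move=> /Xx[].
suff -> : X = setT by [].
apply: Agen.
- split.
  + apply/closed_nrmP => z h w hw.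
    suff H u : (forall e, 0 < e -> exists2 u', approx_words (u' ** w) & nrm (u - u') < e) ->
        approx_words (u ** w).
      split; apply: H => e /h[z' Xz' zz']; first by exists z' => //; have [] := Xz' _ hw.
      by exists z'^#; [have [] := Xz' _ hw|rewrite -cstarB nrm_star].
    move=> hu; have /closed_nrmP := approx_words_closed; apply => e e0.
    have wp : 0 < nrm w + 1 by rewrite ltr_wpDl ?nrm_ge0.
    have [|u' hu' uu'] := hu (e / (nrm w + 1)); first by rewrite divr_gt0.
    exists (u' ** w) => //; rewrite -cmulBl (le_lt_trans (nrm_cmul _ _))//.
    move: uu'; rewrite ltr_pdivlMr//; have := nrm_ge0 (u - u'); nra.
  + split.
      move=> w hw; rewrite cstar0 cmul0l.
      suff : approx_words 0 by [].
      by rewrite -(scale0r w); exact: approx_wordsZ.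
    move=> c u w hu hw z hz; have [uz1 uz2] := hu _ hz; have [wz1 wz2] := hw _ hz.
    rewrite cstarD cstarZ !cmulDl !cmulZl.
    by split; apply: approx_wordsD => //; exact: approx_wordsZ.
  + move=> u w hu hw z hz; rewrite cstarM -!cmulA.
    by split; [apply: (hu _ _).1; apply: (hw _ _).1|apply: (hw _ _).2; apply: (hu _ _).2].
  + by move=> u hu z hz; rewrite cstarK; have [] := hu _ hz.
- move=> e z hz; split; apply: approx_words_mull => // z' [N hN].
    by exists N; rewrite -cmulA; apply: wordsW; exact: edge_words hN.
  (* One further edge makes every word nonempty, so that the adjoint edge finds a letter to
     cancel. *)
  exists N.+1; rewrite -cmulA; apply: edge_star_words; exact: words_trailS hN.
- move=> u z hz; rewrite (ck_selfadj CK).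
  by split; apply: approx_words_mull => // z' [N hN];
    exists N; rewrite -cmulA; exact: vertex_words.
Qed.

(** Letters are compared from the left: the first mismatch makes the product vanish, and without one
    the word is an initial segment of the path. *)
Lemma trail_star_word m k l w : (size l <= k)%N ->
  (trail m k)^# ** word l w = 0 \/ word l w = trail m (size l).
Proof.
elim: l m k => [|e l IH] m k /=.
  move=> _; have [->|/eqP wv] := eqVneq w (v m); first by right.
  left; rewrite -trail_rng cstarM (ck_selfadj CK) -cmulA.
  by rewrite (ck_vertex_orth CK) ?cmul0r//; exact: nesym.
case: k => // k lk /=.
have [<-|/eqP ae] := eqVneq (a m) e; last first.
  left; rewrite cstarM -!cmulA (cmulA (s _)^#) (ck_orth Erf CK)//.
  by rewrite cmul0l cmul0r.
have [h|h] := IH m.+1 k lk; last by right; rewrite h.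
left; rewrite cstarM -cmulA (cmulA (s _)^#) (ck_starK CK) a_path.
by rewrite cmulA -(ck_selfadj CK) -cstarM trail_rng.
Qed.

Lemma span_word K k l w : ret K -> ret k -> (size l + k <= K.*2)%N -> (size l <= K)%N ->
  span K ((T K)^# ** word l w ** T k).
Proof.
move=> rK rk lK lK'; have [->|->] := trail_star_word 0 w lK'.
  by rewrite cmul0l; exact: span0.
rewrite -cmulA; have [rl|rl] := boolP (ret (size l)).
  by rewrite -TD//; apply: span1; rewrite ?retD.
by rewrite T_not_ret// cmul0r; exact: span0.
Qed.

Lemma span_approx x e : x ** P = x -> selfadjoint x -> 0 < e ->
  exists m F, [/\ ret m, span m F, selfadjoint F &
    nrm ((T m)^# ** x ** T m - F) <= e].
Proof.
move=> xP sx e0.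
have : approx_words x.
  rewrite -xP; apply: approx_words_ideal => d d0; exists P.
    by exists 0%N; rewrite PT; exact: (@words1 false [::]).
  by rewrite subrr nrm0.
move=> /(_ _ e0)[y [N0 hN0] /ltW xy].
(* Lengths are rounded up to multiples of [n], which are returns. *)
have := words_trail_le (leq_pmulr N0 n_gt0) hN0.
set N := (N0 * n)%N; have rN : ret N by exact: ret_period.
move=> [r [_ yE]].
(* The sum bounds the length of every word and the factor [n] makes [k] a return, so a trail of
   length N + k covers each word, as [span_word] requires. *)
pose k := ((\sum_(t <- r) size t.1.2) * n)%N.
have rk : ret k by exact: ret_period.
pose K := (N + k)%N; have rK : ret K by rewrite retD.
pose G := (T K)^# ** (y ** T N) ** T k.
have sG : span K G.
  rewrite /G yE cmul_sumr cmul_suml big_seq; apply: span_sum => t tr.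
  rewrite cmulZr cmulZl; apply: spanZ.
  have tk : (size t.1.2 <= k)%N.
    by rewrite /k (big_rem _ tr)/= (leq_trans _ (leq_pmulr _ n_gt0))// leq_addr.
  have tK : (size t.1.2 <= K)%N by rewrite (leq_trans tk)// leq_addl.
  by apply: span_word => //; rewrite -addnn leq_add// leq_addl.
have Gx : nrm ((T K)^# ** x ** T K - G) <= e.
  have TK : T K = T N ** T k by rewrite /K TD.
  rewrite /G [X in _ ** X - _]TK !cmulA -!cmulBl -!cmulBr.
  do 2!rewrite (le_trans (mulr_trail_contractive _ _ _))//.
  by rewrite (le_trans (trail_star_contractive _ _ _)).
exists K, (2^-1 *: (G + G^#)); split=> //.
- by apply: spanZ; apply: spanD => //; exact: span_star.
- by rewrite /selfadjoint cstarZ conj_half cstarD cstarK addrC.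
- set x' := _ ** T K; rewrite -[x' in X in nrm X]half_dbl -scalerBr nrm_half.
  have sx' : x'^# = x' by rewrite /x' !cstarM cstarK sx cmulA.
  have xG : nrm (x' - G^#) = nrm (x' - G) by rewrite -[in LHS]sx' -cstarB nrm_star.
  rewrite opprD addrACA; have := ler_nrmD (x' - G) (x' - G^#); lra.
Qed.

(** The compression x' of [x] has two roles: as an element of I it shows that F is close to I, and
    as an element of the corner it is the vector to which the resulting bound on F is applied. *)
Lemma corner_selfadjoint_eq0 x : corner x -> selfadjoint x -> x = 0.
Proof.
move=> [Ix Px] sx; have xP : x ** P = x by rewrite -{1}sx -(ck_selfadj CK) -cstarM Px.
apply: nrm_small => d d0; have e0 : 0 < d / 3 by rewrite divr_gt0.
have [m [F [rm spF sF Fx]]] := span_approx xP sx e0.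
set x' := _ ** T m in Fx.
have cx' : corner x'.
  rewrite /x'; split; first by apply: perp_mulr; exact: perp_mull.
  by rewrite !cmulA P_starT.
have sx' : selfadjoint x' by rewrite /selfadjoint /x' !cstarM cstarK sx cmulA.
have wF : within (d / 3) F by exists x' => //; [case: cx'|rewrite nrmC].
have hF := span_nrm_within rm sF spF (ltW e0) wF cx'.
(* Here |x'|^2 <= |(x' - F) x'| + |F x'| <= (d/3 + 2 d/3) |x'|, which explains the choice of d/3. *)
have hx' : nrm x' ^+ 2 <= d * nrm x'.
  rewrite -nrm_star_cmul sx'.
  have -> : x' ** x' = (x' - F) ** x' + F ** x' by rewrite -cmulDl subrK.
  rewrite (le_trans (ler_nrmD _ _))//; have := nrm_cmul (x' - F) x'.
  have := nrm_ge0 x'; rewrite mulr2n in hF; nra.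
(* The compression loses no norm, because on I it is undone: x = T m x' (T m)*. *)
have : nrm x <= nrm x'.
  have -> : x = T m ** (x' ** (T m)^#).
    rewrite /x' perp_Ktrail; last exact: perp_mull.
    by rewrite -cmulA xP perp_trailK// Px.
  rewrite (le_trans (trail_contractive _ _ _))// -nrm_star cstarM cstarK.
  by rewrite (le_trans (trail_contractive _ _ _))// nrm_star.
have := nrm_ge0 x'; nra.
Qed.

(** By regularity P lies in J as soon as x P = P x = 0 for all x in I. Both are tested through (x
    P)* (x P) and (P x) (P x)*, self-adjoint elements of the corner. *)
Lemma vertex_not_perp_absurd : False.
Proof.
apply: (@a_notin 0); rewrite Jreg.2 => x Ix.
have PP : P ** P = P by exact: (ck_idem CK).
have Ps : P^# = P by exact: (ck_selfadj CK).
split; last first.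
  apply: cstar_cmul_eq0; apply: corner_selfadjoint_eq0.
    split; first by apply: perp_mull; exact: perp_mulr.
    by rewrite cstarM Ps !cmulA PP.
  by rewrite /selfadjoint cstarM cstarK.
rewrite -[P ** x]cstarK; suff -> : (P ** x)^# = 0 by rewrite cstar0.
apply: cstar_cmul_eq0; rewrite cstarK; apply: corner_selfadjoint_eq0.
  by split; [apply: perp_mulr; exact: perp_mull|rewrite !cmulA PP].
by rewrite /selfadjoint cstarM cstarK.
Qed.

End ReturnPath.

(** * Entries of cycles in the quotient graph *)

Section Entry.
Variables (R : realType) (E : digraph) (A : cstarAlgType R).
Variables (s : edge E -> A) (p : vertex E -> A).
Hypotheses (Erf : row_finite E) (CK : CK_family s p) (Agen : generates s p).
Variables (gam : R[i] -> A -> A) (J : set A).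
Hypotheses (gamP : gauge_action s p gam) (Jgam : gauge_invariant gam J).
Hypothesis (Jreg : regular_ideal J).

Lemma return_path_entry_eq0 (a : nat -> edge E) (n : nat) (e : edge E) :
  (forall k, src (a k) = rng (a k.+1)) -> (0 < n)%N ->
  (forall k, a (k + n)%N = a k) ->
  (forall k f, rng f = rng (a k) -> f <> a k -> J (s f)) ->
  (forall k, ~ J (p (rng (a k)))) ->
  rng e = rng (a 0) -> e <> a 0 -> p (src e) = 0.
Proof.
move=> ap n0 aper aent anot re ea.
have Ip : perp J (p (rng (a 0))).
  apply: contrapT => nI.
  exact: (vertex_not_perp_absurd Erf CK gamP Jgam Jreg ap n0 aper aent anot nI Agen).
have Je : J (s e) by exact: (aent 0).
have := (Ip _ Je).1; rewrite -re (ck_rng Erf CK) => se0.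
by rewrite -(ck_starK CK) se0 cmul0r.
Qed.

Lemma quotient_condition_L : (forall v, p v <> 0) -> condition_L E ->
  condition_L (ideal_quotient_graph p J).
Proof.
move=> p0 EL a l [alp alc]; apply: contrapT => noentry.
pose c := map val (a :: l); pose n := size c.
have [f [e [fc ef ref]]] : exists f e : edge E,
    [/\ f \in c, e <> f & rng e = rng f].
  apply: (EL (val a) (map val l)); split.
    rewrite /is_path path_map; apply: sub_path alp => x y /= /eqP/(congr1 val)/= ->.
    exact: eqxx.
  by rewrite last_map; have := congr1 val alc.
(* The cycle is unrolled periodically starting at [f], so that the entry given by Condition (L) sits
   at index 0. *)
pose i0 := index f c.
pose b k := nth f c ((i0 + k) %% n).
have n0 : (0 < n)%N by [].
have i0n : (i0 < n)%N by rewrite index_mem.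
have b0 : b 0%N = f by rewrite /b addn0 modn_small// nth_index.
have bin k : exists2 x : quotient_edge (ideal_vertices p J), x \in a :: l & b k = val x.
  have : b k \in c by rewrite mem_nth// ltn_mod.
  by move=> /mapP[x xl ->]; exists x.
have bper k : b (k + n)%N = b k by rewrite /b addnA modnDr.
have bpath k : src (b k) = rng (b k.+1).
  have step j : (j < n)%N -> src (nth f c j) = rng (nth f c (j.+1 %% n)).
    rewrite /n /c size_map /= ltnS leq_eqVlt => /orP[/eqP ->|jl].
      rewrite modnn /= -[size l](size_map val) -last_nth last_map.
      by have := congr1 val alc.
    have /(pathP a)/(_ _ jl)/eqP/(congr1 val)/= := alp.
    rewrite modn_small// -map_cons !(nth_map a)//= ltnW//.
  by rewrite /b step ?ltn_mod// addnS -addn1 -[in RHS]addn1 modnDml.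
have bnot k : ~ J (p (rng (b k))).
  by have [x _ ->] := bin k; have /andP[_ /set_mem] := valP x.
(* If s_g is not in J, then neither is p_(src g), so [g] survives in E/J and would be an entry
   there. *)
have bent k g : rng g = rng (b k) -> g <> b k -> J (s g).
  move=> rg gb; apply: contrapT => Js.
  have Jsg : ~ J (p (src g)).
    by rewrite -(ck_src CK) in Js => /(ideal_mull Jreg (s g)).
  have gq : (src g \in ~` ideal_vertices p J) && (rng g \in ~` ideal_vertices p J).
    by rewrite rg; apply/andP; split; apply/mem_set => //; exact: bnot.
  have [x xl bx] := bin k.
  apply: noentry; exists x, (exist _ g gq); split => //.
    by move=> gx; apply: gb; rewrite bx -gx.
  by apply: val_inj; rewrite /= rg bx.
apply: (p0 (src e)); apply: (return_path_entry_eq0 bpath n0 bper bent bnot).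
  by rewrite b0.
by rewrite b0.
Qed.

End Entry.

(** * The Hilbert space l2 and its bounded operators *)

Section L2.
Variables (R : realType) (X : choiceType).

Definition sqmod (z : R[i]) : R := complex.Re z ^+ 2 + complex.Im z ^+ 2.

Lemma sqmod_ge0 z : 0 <= sqmod z.
Proof. by rewrite addr_ge0// sqr_ge0. Qed.

Lemma sqmod_eq0 z : sqmod z = 0 -> z = 0.
Proof.
case: z => a b /eqP; rewrite /sqmod/= paddr_eq0 ?sqr_ge0// !sqrf_eq0.
by move=> /andP[/eqP -> /eqP ->].
Qed.

Lemma sqmodD_le z w : sqmod (z + w) <= sqmod z + sqmod z + (sqmod w + sqmod w).
Proof.
case: z w => [a b] [c d]; rewrite /sqmod/=.
have := sqr_ge0 (a - c); have := sqr_ge0 (b - d); nra.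
Qed.

Lemma sqmodM z w : sqmod (z * w) = sqmod z * sqmod w.
Proof. by case: z w => [a b] [c d]; rewrite /sqmod/=; ring. Qed.

Definition sqsum (f : X -> R[i]^o) : \bar R := \esum_(x in [set: X]) (sqmod (f x))%:E.

Lemma sqsum_ge0 f : (0 <= sqsum f)%E.
Proof. by apply: esum_ge0 => x _; rewrite lee_fin sqmod_ge0. Qed.

Lemma sqsumZ_le (c : R[i]) f : (sqsum (c *: f)%R <= (sqmod c)%:E * sqsum f)%E.
Proof.
apply: ge_ereal_sup => /= _ [F [finF _] <-].
rewrite (eq_fsbigr (fun x => (sqmod c)%:E * (sqmod (f x))%:E)%E); last first.
  by move=> x _; rewrite -EFinM -sqmodM.
rewrite -ge0_mule_fsumr; last by move=> x; rewrite lee_fin sqmod_ge0.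
rewrite lee_wpmul2l ?lee_fin ?sqmod_ge0//.
by apply: ereal_sup_ubound; exists F.
Qed.

Lemma sqsumD_le f g : (sqsum (f + g)%R <= 2%:E * sqsum f + 2%:E * sqsum g)%E.
Proof.
have le2 (h : X -> R[i]^o) : (2%:E * sqsum h = sqsum h + sqsum h)%E.
  by rewrite -[2]/(1 + 1) EFinD ge0_muleDl ?lee_fin// mul1e.
rewrite !le2 /sqsum -!esumD; try by move=> x _; rewrite ?adde_ge0 ?lee_fin ?sqmod_ge0.
apply: le_esum => x _; rewrite -!EFinD lee_fin.
exact: sqmodD_le.
Qed.

Definition l2_pred : {pred X -> R[i]^o} := [pred f | (sqsum f < +oo)%E].

Fact l2_submod : submod_closed l2_pred.
Proof.
split=> [|c f g]; rewrite !inE.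
  by rewrite /sqsum esum1// => x _; rewrite /sqmod/= expr0n addr0.
move=> fl gl; apply: (le_lt_trans (sqsumD_le _ _)).
have fin2 (h : \bar R) : (0 <= h)%E -> (h < +oo)%E -> (2%:E * h < +oo)%E.
  by case: h => // r _ _; rewrite -EFinM ltry.
apply: lte_add_pinfty; apply: fin2; rewrite ?sqsum_ge0//.
apply: (le_lt_trans (sqsumZ_le _ _)); rewrite lte_mul_pinfty ?lee_fin ?sqmod_ge0//.
Qed.
HB.instance Definition _ := GRing.isSubmodClosed.Build R[i] (X -> R[i]^o) l2_pred l2_submod.

Definition l2 : Type := {f : X -> R[i]^o | f \in l2_pred}.
HB.instance Definition _ := [isSub of l2 for @sval _ _].
HB.instance Definition _ := [Choice of l2 by <:].
HB.instance Definition _ := [SubChoice_isSubLmodule of l2 by <:].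

Implicit Types f g h : l2.

Lemma l2_ext f g : (forall x, val f x = val g x) -> f = g.
Proof. by move=> fg; apply: val_inj; apply/funext. Qed.

Lemma l2DE f g x : val (f + g) x = val f x + val g x.
Proof. by []. Qed.

Lemma l2ZE (c : R[i]) f x : val (c *: f) x = c * val f x.
Proof. by []. Qed.

Lemma l2BE f g x : val (f - g) x = val f x - val g x.
Proof. by []. Qed.

Definition sqn f : R := fine (sqsum (val f)).

Lemma sqnE f : (sqn f)%:E = sqsum (val f).
Proof.
rewrite fineK// ge0_fin_numE ?sqsum_ge0//.
by have := valP f.
Qed.

Lemma sqn_ge0 f : 0 <= sqn f.
Proof. by rewrite -lee_fin sqnE sqsum_ge0. Qed.

(** Carries pointwise identities between sums of squared moduli over to the norms; the laws of [ip]
    are reduced to such identities. *)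
Lemma sqn_sum (s t : seq l2) :
  (forall x, \sum_(f <- s) sqmod (val f x) = \sum_(f <- t) sqmod (val f x)) ->
  \sum_(f <- s) sqn f = \sum_(f <- t) sqn f.
Proof.
have E (r : seq l2) : (\sum_(f <- r) sqn f)%:E =
    \esum_(x in [set: X]) (\sum_(f <- r) sqmod (val f x))%:E.
  rewrite -sumEFin; under eq_bigr do rewrite sqnE.
  rewrite -esum_sum; last by move=> *; rewrite lee_fin sqmod_ge0.
  by apply: eq_esum => x _; rewrite sumEFin.
by move=> st; apply: EFin_inj; rewrite !E; apply: eq_esum => x _; rewrite st.
Qed.

Lemma sqmod_le_sqn f x : sqmod (val f x) <= sqn f.
Proof.
rewrite -lee_fin sqnE; apply: esum_ge; exists [set x]; last by rewrite fsbig_set1.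
by split => //; exact: finite_set1.
Qed.

Lemma sqn_eq0 f : sqn f = 0 -> f = 0.
Proof.
move=> f0; apply: l2_ext => x; apply: sqmod_eq0; apply/eqP.
by rewrite eq_le sqmod_ge0 -f0 sqmod_le_sqn.
Qed.

Lemma sqnZ (c : R[i]) f : sqn (c *: f) = sqmod c * sqn f.
Proof.
have le (d : R[i]) g : sqn (d *: g) <= sqmod d * sqn g.
  by rewrite -lee_fin EFinM !sqnE sqsumZ_le.
apply/le_anti; rewrite le/=; have [->|c0] := eqVneq c 0.
  by rewrite {1}/sqmod/= expr0n addr0 mul0r sqn_ge0.
have := le c^-1 (c *: f); rewrite scalerA mulVf// scale1r.
have cp : 0 < sqmod c.
  rewrite lt_neqAle sqmod_ge0 andbT eq_sym; apply: contra_neq c0; exact: sqmod_eq0.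
rewrite -(ler_pM2l cp) mulrA -sqmodM mulfV//.
by rewrite {2}/sqmod/= expr1n expr0n addr0 mul1r.
Qed.

(** The real part of the usual inner product, by polarization, so that sums of squares are the only
    series involved. *)
Definition ip f g : R := (sqn (f + g) - sqn f - sqn g) / 2.

Lemma ipC f g : ip f g = ip g f.
Proof. by rewrite /ip [f + g]addrC; congr (_ / _); ring. Qed.

Lemma ipDl f g h : ip (f + g) h = ip f h + ip g h.
Proof.
have := @sqn_sum [:: f + g + h; f; g; h] [:: f + g; f + h; g + h].
rewrite !big_cons !big_nil => H.
suff : sqn (f + g + h) + (sqn f + (sqn g + (sqn h + 0))) =
  sqn (f + g) + (sqn (f + h) + (sqn (g + h) + 0)).
  rewrite /ip {H}; move: (sqn (f + g + h)) (sqn (f + g)) (sqn (f + h)) (sqn (g + h)).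
  by move: (sqn f) (sqn g) (sqn h) => *; rewrite -mulrDl; congr (_ / 2); lra.
apply: H => x; rewrite !big_cons !big_nil !l2DE.
by case: (val f x) (val g x) (val h x) => [a b] [c d] [k l]; rewrite /sqmod/=; ring.
Qed.

Lemma ipZl (c : R[i]) f g : ip (c *: f) g = ip f (Num.conj c *: g).
Proof.
have := @sqn_sum [:: c *: f + g; f; Num.conj c *: g] [:: f + Num.conj c *: g; c *: f; g].
rewrite !big_cons !big_nil => H.
suff : sqn (c *: f + g) + (sqn f + (sqn (Num.conj c *: g) + 0)) =
  sqn (f + Num.conj c *: g) + (sqn (c *: f) + (sqn g + 0)) by rewrite /ip {H}; lra.
apply: H => x; rewrite !big_cons !big_nil !l2DE !l2ZE.
by case: c (val f x) (val g x) => [a b] [c d] [k l]; rewrite /sqmod/=; ring.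
Qed.

Lemma sqmod_real (t : R) : sqmod t%:C = t ^+ 2.
Proof. by rewrite /sqmod/= expr0n addr0. Qed.

Lemma ipff f : ip f f = sqn f.
Proof.
rewrite /ip; have -> : f + f = 2%:C *: f.
  by rewrite -[X in X + X]scale1r -scalerDl -[2]/(1 + 1) rmorphD rmorph1.
by rewrite sqnZ sqmod_real; field.
Qed.

Lemma ipDr f g h : ip f (g + h) = ip f g + ip f h.
Proof. by rewrite ipC ipDl !(ipC f). Qed.

Lemma ip0l f : ip 0 f = 0.
Proof. by have := ipDl 0 0 f; rewrite addr0; lra. Qed.

Lemma ipNl f g : ip (- f) g = - ip f g.
Proof. by have := ipDl (- f) f g; rewrite addNr ip0l; lra. Qed.

Lemma ipBl f g h : ip (f - g) h = ip f h - ip g h.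
Proof. by rewrite ipDl ipNl. Qed.

Lemma ipBr f g h : ip f (g - h) = ip f g - ip f h.
Proof. by rewrite ipC ipBl !(ipC f). Qed.

Lemma ip_real (t : R) f g : ip (t%:C *: f) g = t * ip f g.
Proof.
wlog t0 : t / 0 <= t => [H|].
  have [/H//|t0] := leP 0 t.
  have := H (- t); rewrite oppr_ge0 (ltW t0) => /(_ isT).
  by rewrite rmorphN scaleNr ipNl; lra.
(* [sqn_sum] carries no weights, so the weight t is realized as scaling by its square root. *)
set r := (Num.sqrt t)%:C.
have rr : sqmod r = t by rewrite /r sqmod_real sqr_sqrtr.
have := @sqn_sum [:: t%:C *: f + g; r *: f; r *: g] [:: r *: (f + g); t%:C *: f; g].
rewrite !big_cons !big_nil !sqnZ rr => H.
suff : sqn (t%:C *: f + g) + (t * sqn f + (t * sqn g + 0)) =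
  t * sqn (f + g) + (sqmod t%:C * sqn f + (sqn g + 0)).
  rewrite /ip sqnZ {H}; move: (sqn (t%:C *: f + g)) (sqn (f + g)) (sqmod t%:C).
  by move: (sqn f) (sqn g) => *; rewrite mulrA; congr (_ / 2); lra.
apply: H => x; rewrite !big_cons !big_nil !l2ZE !l2DE !l2ZE !sqmodM rr.
by case: (val f x) (val g x) => [c d] [k l]; rewrite /sqmod/=; ring.
Qed.

Definition hn f : R := Num.sqrt (sqn f).

Lemma hn_ge0 f : 0 <= hn f. Proof. exact: sqrtr_ge0. Qed.

Lemma hn_sq f : hn f ^+ 2 = sqn f.
Proof. by rewrite sqr_sqrtr ?sqn_ge0. Qed.

Lemma hn0_eq0 f : hn f = 0 -> f = 0.
Proof. by move=> f0; apply: sqn_eq0; rewrite -hn_sq f0 expr0n. Qed.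

Lemma hn0 : hn 0 = 0.
Proof. by rewrite /hn -ipff ip0l sqrtr0. Qed.

Lemma hnZ (c : R[i]) f : hn (c *: f) = complex.Re `|c| * hn f.
Proof.
rewrite /hn sqnZ sqrtrM ?sqmod_ge0//; congr (_ * _).
by rewrite normc_def.
Qed.

Lemma ip_le f g : ip f g <= hn f * hn g.
Proof.
have [g0|g0] := eqVneq (hn g) 0.
  by rewrite (hn0_eq0 g0) ipC ip0l hn0 mulr0.
have gp : 0 < hn g by rewrite lt_neqAle eq_sym g0 hn_ge0.
have key : 0 <= sqn ((hn g)%:C *: f - (hn f)%:C *: g) := sqn_ge0 _.
rewrite -ipff !(ipBl, ipBr, ip_real) !(ipC f) !ip_real !(ipC g) !ip_real !ipff -!hn_sq in key.
rewrite ?(ipC g f) in key.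
have [f0|f0] := eqVneq (hn f) 0; first by rewrite (hn0_eq0 f0) ip0l hn0 mul0r.
have fp : 0 < hn f by rewrite lt_neqAle eq_sym f0 hn_ge0.
have fg : 0 < hn f * hn g by rewrite mulr_gt0.
nra.
Qed.

Lemma normr_ip_le f g : `|ip f g| <= hn f * hn g.
Proof.
rewrite ler_norml ip_le andbT lerNl -ipNl (le_trans (ip_le _ _))//.
by rewrite -scaleN1r hnZ normrN1 mul1r.
Qed.

Lemma ler_hnD f g : hn (f + g) <= hn f + hn g.
Proof.
rewrite -(ler_pXn2r (n := 2)) ?nnegrE ?addr_ge0 ?hn_ge0//.
rewrite hn_sq -ipff ipDl !ipDr !ipff (ipC g) -!hn_sq.
by have := ip_le f g; lra.
Qed.

End L2.

Section L2Complete.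
Variables (R : realType) (X : choiceType).
Local Notation H := (l2 R X).

Lemma real_cauchy_seq_lim (g : nat -> R) (e : nat -> R) :
  (forall n m, (n <= m)%N -> `|g m - g n| <= e n) ->
  (forall d, 0 < d -> exists n, e n < d) -> cvg (g @ \oo).
Proof.
move=> ge e0; apply/cauchy_cvgP/cauchy_exP => d /e0[n nd].
exists (g n), n => // m /= nm.
by rewrite -ball_normE/= distrC (le_lt_trans _ nd)// ge.
Qed.

Lemma sqmod_ge_Re (z : R[i]) : `|complex.Re z| ^+ 2 <= sqmod z.
Proof. by rewrite real_normK ?num_real// lerDl sqr_ge0. Qed.

Lemma sqmod_ge_Im (z : R[i]) : `|complex.Im z| ^+ 2 <= sqmod z.
Proof. by rewrite real_normK ?num_real// lerDr sqr_ge0. Qed.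

Lemma fsum_sqmod_le (f : H) (F : set X) : finite_set F ->
  \sum_(x \in F) sqmod (val f x) <= sqn f.
Proof.
move=> finF; rewrite -lee_fin sqnE; apply: esum_ge; exists F => //.
by rewrite fsbig_finite// [in leRHS]fsbig_finite// sumEFin.
Qed.

Lemma l2_complete (u : nat -> H) (e : nat -> R) :
  (forall n m, (n <= m)%N -> hn (u m - u n) <= e n) ->
  (forall d, 0 < d -> exists n, e n < d) ->
  exists l, forall n, hn (l - u n) <= e n.
Proof.
move=> ue e0.
have en n : 0 <= e n by rewrite (le_trans _ (ue _ _ (leqnn n)))// hn_ge0.
have comp (t : R[i] -> R) x : (forall z, `|t z| ^+ 2 <= sqmod z) ->
    (forall z w, t (z - w) = t z - t w) -> cvg ((fun n => t (val (u n) x)) @ \oo).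
  move=> tz tB; apply: real_cauchy_seq_lim e0 => n m nm.
  rewrite -tB -l2BE (le_trans _ (ue _ _ nm))//.
  rewrite -(ler_pXn2r (n := 2)) ?nnegrE ?hn_ge0// hn_sq.
  exact: (le_trans (tz _) (sqmod_le_sqn _ _)).
have cRe x := comp (@complex.Re R) x sqmod_ge_Re (raddfB _).
have cIm x := comp (@complex.Im R) x sqmod_ge_Im (raddfB _).
pose l x : R[i]^o := lim ((fun n => complex.Re (val (u n) x)) @ \oo)
  +i* lim ((fun n => complex.Im (val (u n) x)) @ \oo).
(* The Cauchy bound passes to the pointwise limit on each finite set, and then to the supremum over
   finite sets. *)
have bound n : (sqsum (l - val (u n))%R <= (e n ^+ 2)%:E)%E.
  apply: ge_ereal_sup => /= _ [F [finF _] <-].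
  rewrite fsbig_finite//= sumEFin lee_fin.
  set r := finmap.enum_fset (fset_set F).
  have cv : (fun m => \sum_(x <- r) sqmod (val (u m) x - val (u n) x)) @ \oo -->
      \sum_(x <- r) sqmod (l x - val (u n) x).
    apply: (cvg_big (op := +%R)) => [|x _]; first exact: add_continuous.
    have cvx : (fun m => complex.Re (val (u m) x) - complex.Re (val (u n) x)) @ \oo
      --> complex.Re (l x) - complex.Re (val (u n) x).
      by apply: cvgB; [exact: cRe|exact: cvg_cst].
    have cvy : (fun m => complex.Im (val (u m) x) - complex.Im (val (u n) x)) @ \oo
      --> complex.Im (l x) - complex.Im (val (u n) x).
      by apply: cvgB; [exact: cIm|exact: cvg_cst].
    rewrite /sqmod !raddfB.
    have -> : (fun m => complex.Re (val (u m) x - val (u n) x) ^+ 2 +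
       complex.Im (val (u m) x - val (u n) x) ^+ 2) =
      (fun m => (complex.Re (val (u m) x) - complex.Re (val (u n) x)) *
                (complex.Re (val (u m) x) - complex.Re (val (u n) x)) +
                (complex.Im (val (u m) x) - complex.Im (val (u n) x)) *
                (complex.Im (val (u m) x) - complex.Im (val (u n) x))).
      by apply/funext => m; rewrite !raddfB !expr2.
    rewrite !expr2; apply: cvgD; exact: cvgM.
  rewrite -(cvg_lim _ cv)//; apply: limr_le; first by apply/cvg_ex; exists (\sum_(x <- r) sqmod (l x - val (u n) x)).
  exists n => // m /= nm.
  have -> : \sum_(x <- r) sqmod (val (u m) x - val (u n) x) =
      \sum_(x \in F) sqmod (val (u m - u n) x) by rewrite fsbig_finite.
  rewrite (le_trans (fsum_sqmod_le _ finF))// -hn_sq.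
  by rewrite ler_pXn2r ?nnegrE ?hn_ge0 ?en// ue.
have l2l n : (l - val (u n))%R \in @l2_pred R X.
  by rewrite inE (le_lt_trans (bound n))// ltry.
(* Square summability is known for l - u 0; adding u 0 back gives the limit as an element of l2. *)
pose l0 : H := exist (fun f => f \in @l2_pred R X) _ (l2l 0%N).
pose l' : H := l0 + u 0%N.
exists l' => n; rewrite -(ler_pXn2r (n := 2)) ?nnegrE ?hn_ge0 ?en// hn_sq.
rewrite -lee_fin sqnE (_ : val (l' - u n) = (l - val (u n))%R) ?bound//.
by apply/funext => x; rewrite l2BE l2DE /= subrK.
Qed.

End L2Complete.

(** * Operators with an adjoint *)

Section BoundedOperators.
Variables (R : realType) (X : choiceType).
Local Notation H := (l2 R X).
Implicit Types (T S : H -> H) (f g : H).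

Definition adjoint_to T S := forall f g, ip (T f) g = ip f (S g).
Definition bounded_by T (M : R) := forall f, hn (T f) <= M * hn f.

Lemma adjoint_unique T S S' : adjoint_to T S -> adjoint_to T S' -> S = S'.
Proof.
move=> TS TS'; apply/funext => g; apply/eqP; rewrite -subr_eq0; apply/eqP.
by apply: sqn_eq0; rewrite -ipff ipBr -TS -TS' subrr.
Qed.

Lemma adjoint_sym T S : adjoint_to T S -> adjoint_to S T.
Proof. by move=> TS f g; rewrite ipC -TS ipC. Qed.

Lemma adjointD T S : adjoint_to T S -> {morph T : f g / f + g}.
Proof.
move=> TS f g; apply/eqP; rewrite -subr_eq0; apply/eqP; apply: sqn_eq0.
rewrite -ipff; set u := (X in ip _ X); rewrite ipBl ipDl !TS ipDl.
by rewrite subrr.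
Qed.

(* [ip] is a real inner product, so adjoints are only real linear in general:
   conjugation is its own adjoint. *)
Definition homogeneous T := forall (c : R[i]) f, T (c *: f) = c *: T f.

Lemma adjoint_homogeneous T S : adjoint_to T S -> homogeneous T -> homogeneous S.
Proof.
move=> TS Th c g; apply/eqP; rewrite -subr_eq0; apply/eqP; apply: sqn_eq0.
rewrite -ipff; set u := (X in ip X _); rewrite ipBr -TS.
have cE : c = Num.conj (Num.conj c : R[i]) by rewrite conjCK.
rewrite [X in ip (T u) (X *: _)]cE [X in ip u (X *: _)]cE -!ipZl.
by rewrite -Th TS subrr.
Qed.

Lemma adjoint_bounded T S M : 0 <= M -> adjoint_to T S -> bounded_by T M -> bounded_by S M.
Proof.
move=> M0 TS TM g; have [->|S0] := eqVneq (hn (S g)) 0; first by rewrite mulr_ge0 ?hn_ge0.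
have Sp : 0 < hn (S g) by rewrite lt_neqAle eq_sym S0 hn_ge0.
rewrite -(ler_pM2l Sp) -expr2 hn_sq -ipff -TS (le_trans (ip_le _ _))//.
have := TM (S g); have := hn_ge0 g; nra.
Qed.

(** Demanding an adjoint yields additivity, supplies the involution and is stable under norm
    limits. *)
Definition bop_prop T := exists S M,
  [/\ homogeneous T, adjoint_to T S, 0 <= M & bounded_by T M].
Definition bop_pred : {pred H -> H} := [pred T | `[< bop_prop T >]].

Fact bop_submod : submod_closed bop_pred.
Proof.
split=> [|c T T']; rewrite !inE.
  do 2!apply/asboolP; exists (fun=> 0), 0; split=> //.
  - by move=> d f; rewrite scaler0.
  - by move=> f g; rewrite ip0l ipC ip0l.
  - by move=> f; rewrite mul0r hn0.
move=> [S [M [Th TS M0 TM]]] [S' [M' [Th' TS' M0' TM']]].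
exists (fun g => Num.conj c *: S g + S' g), (complex.Re `|c| * M + M').
have c0 : 0 <= complex.Re `|c| by rewrite normc_def/= sqrtr_ge0.
split.
- move=> d f; rewrite -[LHS]/(c *: T (d *: f) + T' (d *: f)) Th Th' scalerDr.
  by rewrite !scalerA mulrC.
- move=> f g; rewrite ipDl ipDr ipZl TS TS'.
  by rewrite (adjoint_homogeneous TS Th).
- by rewrite addr_ge0// mulr_ge0.
- move=> f; rewrite (le_trans (ler_hnD _ _))// mulrDl lerD//.
  by rewrite hnZ -mulrA ler_wpM2l.
Qed.
HB.instance Definition _ := GRing.isSubmodClosed.Build R[i] (H -> H) bop_pred bop_submod.

Definition bop : Type := {T : H -> H | T \in bop_pred}.
HB.instance Definition _ := [isSub of bop for @sval _ _].
HB.instance Definition _ := [Choice of bop by <:].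
HB.instance Definition _ := [SubChoice_isSubLmodule of bop by <:].

End BoundedOperators.

Lemma sequentially_complete (R : realType) (V : normedModType R[i]) :
  (forall (u : nat -> V) (e : nat -> R),
    (forall n m, (n <= m)%N -> nrm (u m - u n) <= e n) ->
    (forall d, 0 < d -> exists n, e n < d) ->
    exists l, forall n, nrm (l - u n) <= e n) ->
  forall F : set_system V, ProperFilter F -> cauchy F -> cvg F.
Proof.
move=> Vlim F FF /cauchyP FC.
have [e [e0 e_le e_small]] : exists e : nat -> R, [/\ forall n, 0 < e n,
    forall n m, (n <= m)%N -> e m <= e n & forall d, 0 < d -> exists n, e n < d].
  exists (fun n => n.+1%:R^-1); split=> [n|n m nm|d d0].
  - by rewrite invr_gt0.
  - by rewrite lef_pV2 ?posrE// ler_nat.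
  - exists (Num.bound d^-1); rewrite -[ltRHS]invrK ltf_pV2 ?posrE ?invr_gt0//.
    rewrite (lt_trans (archi_boundP _)) ?invr_ge0 ?(ltW d0)//.
    by rewrite ltr_nat.
have /choice[u uF] (n : nat) : exists x : V, F (ball x (e n)%:C).
  by apply: FC; rewrite ltcR.
have ub n m : (n <= m)%N -> nrm (u m - u n) <= e n + e n.
  move=> /e_le emn.
  have [y [/ball_nrmP ym /ball_nrmP yn]] := filter_ex (filterI (uF m) (uF n)).
  have := ler_nrm_trans (u m) y (u n); rewrite (nrmC y); lra.
have [|l hl] := Vlim u _ ub.
  move=> d d0; have [|n nd] := e_small (d / 2); first by rewrite divr_gt0.
  by exists n; lra.
apply/cvg_ex; exists l; apply/near_nrmP => d d0.
have [|n nd] := e_small (d / 3); first by rewrite divr_gt0.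
apply: filterS (uF n) => y /ball_nrmP yn.
have := ler_nrm_trans l (u n) y; have := hl n; lra.
Qed.

(** * The operator norm and the C*-structure *)

Section OperatorNorm.
Variables (R : realType) (X : choiceType).
Local Notation H := (l2 R X).
Local Notation B := (bop R X).
Implicit Types (S T : B) (f g : H) (c : R[i]).

Lemma bopP T : bop_prop (val T).
Proof. by have /asboolP := valP T. Qed.

Lemma bop_ext S T : (forall f, val S f = val T f) -> S = T.
Proof. by move=> h; apply: val_inj; apply/funext. Qed.

Lemma bopDE S T f : val (S + T) f = val S f + val T f. Proof. by []. Qed.
Lemma bopBE S T f : val (S - T) f = val S f - val T f. Proof. by []. Qed.
Lemma bopZE c T f : val (c *: T) f = c *: val T f. Proof. by []. Qed.

Definition adj T : H -> H := sval (cid (bopP T)).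

Lemma adjP T : adjoint_to (val T) (adj T).
Proof. by rewrite /adj; case: cid => S [M []]. Qed.

Lemma bopZ T : homogeneous (val T).
Proof. by have [S [M []]] := bopP T. Qed.

Lemma bopD T : {morph val T : f g / f + g}.
Proof. exact: (adjointD (@adjP T)). Qed.

(** The condition 0 <= M keeps the set bounded below when [X] is empty and every real number is a
    bound. *)
Definition opn T : R := inf [set M | 0 <= M /\ bounded_by (val T) M].

Let opn_has_inf T : has_inf [set M | 0 <= M /\ bounded_by (val T) M].
Proof.
split; last by exists 0 => M [].
by have [S [M [_ _ M0 TM]]] := bopP T; exists M.
Qed.

Lemma opn_ge0 T : 0 <= opn T.
Proof. by apply: lb_le_inf => [|M []//]; have [] := opn_has_inf T. Qed.

Lemma opn_le T M : 0 <= M -> bounded_by (val T) M -> opn T <= M.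
Proof. by move=> M0 TM; apply: ge_inf => //; have [] := opn_has_inf T. Qed.

Lemma opn_bound T : bounded_by (val T) (opn T).
Proof.
move=> f; have [f0|f0] := eqVneq (hn f) 0.
  have [S [M [_ _ M0 /(_ f)]]] := bopP T.
  by rewrite f0 !mulr0.
have fp : 0 < hn f by rewrite lt_neqAle eq_sym f0 hn_ge0.
rewrite -ler_pdivrMr//; apply: lb_le_inf; first by have [] := opn_has_inf T.
by move=> M [_ TM]; rewrite ler_pdivrMr.
Qed.

Lemma opnD S T : opn (S + T) <= opn S + opn T.
Proof.
apply: opn_le => [|f]; first by rewrite addr_ge0 ?opn_ge0.
by rewrite bopDE (le_trans (ler_hnD _ _))// mulrDl lerD ?opn_bound.
Qed.

Lemma opnZ c T : opn (c *: T) = complex.Re `|c| * opn T.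
Proof.
have n0 d : 0 <= complex.Re `|d : R[i]| by rewrite normc_def/= sqrtr_ge0.
have le d S : opn (d *: S) <= complex.Re `|d| * opn S.
  apply: opn_le => [|f]; first by rewrite mulr_ge0// opn_ge0.
  by rewrite bopZE hnZ -mulrA ler_wpM2l// opn_bound.
apply/le_anti; rewrite le andTb; have [->|c0] := eqVneq c 0.
  by rewrite normr0/= mul0r opn_ge0.
have := le c^-1 (c *: T); rewrite scalerA mulVf// scale1r.
have cp : 0 < complex.Re `|c|.
  by rewrite -ltcR RRe_real ?normr_real// normr_gt0.
rewrite -(ler_pM2l cp) mulrA normfV.
suff -> : complex.Re `|c| * complex.Re `|c|^-1 = 1 by rewrite mul1r.
have ncE : `|c| = (complex.Re `|c|)%:C by rewrite RRe_real ?normr_real.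
by rewrite {2}ncE -fmorphV /= mulfV// gt_eqF.
Qed.

Lemma opn0_eq0 T : opn T = 0 -> T = 0.
Proof.
move=> T0; apply: bop_ext => f; apply: hn0_eq0; apply/eqP.
by rewrite eq_le hn_ge0 (le_trans (opn_bound _ _))// T0 mul0r.
Qed.

Definition bop_norm T : R[i] := (opn T)%:C.

Fact bop_normD S T : bop_norm (S + T) <= bop_norm S + bop_norm T.
Proof. by rewrite /bop_norm -rmorphD lecR opnD. Qed.

Fact bop_normZ c T : bop_norm (c *: T) = `|c| * bop_norm T.
Proof.
by rewrite /bop_norm opnZ rmorphM; congr (_ * _); exact: RRe_real (normr_real _).
Qed.

Fact bop_norm0_eq0 T : bop_norm T = 0 -> T = 0.
Proof. by move=> /complexI/opn0_eq0. Qed.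

HB.instance Definition _ :=
  Lmodule_isNormed.Build R[i] (bop R X) bop_normD bop_normZ bop_norm0_eq0.

Lemma nrm_bop T : nrm T = opn T.
Proof. by []. Qed.

(** The adjoints converge pointwise at the same rate, and their limit is an adjoint of the limit
    operator. *)
Lemma bop_cauchy_seq_lim (u : nat -> B) (e : nat -> R) :
  (forall n m, (n <= m)%N -> nrm (u m - u n) <= e n) ->
  (forall d, 0 < d -> exists n, e n < d) ->
  exists l, forall n, nrm (l - u n) <= e n.
Proof.
move=> ue e0.
have en n : 0 <= e n by rewrite (le_trans (nrm_ge0 _) (ue _ _ (leqnn n))).
have adjB S T f : adj (S - T) f = adj S f - adj T f.
  suff -> : adj (S - T) = (fun f => adj S f - adj T f) by [].
  apply: (adjoint_unique (@adjP (S - T))) => g h.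
  by rewrite bopBE ipBl ipBr !adjP.
have lim_of (v : nat -> H -> H) :
    (forall f n m, (n <= m)%N -> hn (v m f - v n f) <= e n * hn f) ->
    exists l : H -> H, forall f n, hn (l f - v n f) <= e n * hn f.
  move=> ve; suff /choice[l hl] : forall f, exists l, forall n,
      hn (l - v n f) <= e n * hn f by exists l.
  move=> f; apply: l2_complete => [n m /ve//|d d0].
  have fp : 0 < hn f + 1 by rewrite ltr_wpDl ?hn_ge0.
  have [|n] := e0 (d / (hn f + 1)); first by rewrite divr_gt0.
  rewrite ltr_pdivlMr// => nd; exists n; apply: le_lt_trans nd.
  by rewrite ler_wpM2l// lerDl.
have [|l hl] := lim_of (fun n => val (u n)).
  move=> f n m nm; rewrite -bopBE (le_trans (opn_bound _ _))//.
  by rewrite ler_wpM2r ?hn_ge0// ue.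
have [|l' hl'] := lim_of (fun n => adj (u n)).
  move=> f n m nm; rewrite -adjB.
  apply: (adjoint_bounded (en n) (@adjP (u m - u n))) => g.
  by rewrite (le_trans (opn_bound _ _))// ler_wpM2r ?hn_ge0// ue.
have small (r : R) K : 0 <= K -> (forall n, `|r| <= e n * K) -> r = 0.
  move=> K0 h; apply/eqP; rewrite -normr_le0; apply/ler_addgt0Pr => d d0.
  have Kp : 0 < K + 1 by rewrite ltr_wpDl.
  have [|n] := e0 (d / (K + 1)); first by rewrite divr_gt0.
  rewrite ltr_pdivlMr// => nd; rewrite add0r (le_trans (h n))//.
  by rewrite (le_trans _ (ltW nd))// ler_wpM2l// lerDl.
have adjl : adjoint_to l l'.
  move=> f g; apply/eqP; rewrite -subr_eq0; apply/eqP.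
  apply: (@small _ (hn f * hn g + hn f * hn g)).
    by rewrite addr_ge0// mulr_ge0 ?hn_ge0.
  move=> n.
  have -> : ip (l f) g - ip f (l' g) =
      ip (l f - val (u n) f) g - ip f (l' g - adj (u n) g).
    by rewrite ipBl ipBr (adjP (u n)); ring.
  rewrite (le_trans (ler_normB _ _))// mulrDr lerD//.
    rewrite (le_trans (normr_ip_le _ _))// mulrA ler_wpM2r ?hn_ge0//.
  by rewrite (le_trans (normr_ip_le _ _))// mulrCA ler_wpM2l ?hn_ge0.
have lZ : homogeneous l.
  move=> c f; apply/eqP; rewrite -subr_eq0; apply/eqP; apply: hn0_eq0.
  apply: (@small _ (hn (c *: f) + complex.Re `|c| * hn f)).
    rewrite addr_ge0 ?hn_ge0// mulr_ge0 ?hn_ge0//.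
    by rewrite normc_def/= sqrtr_ge0.
  move=> n; rewrite ger0_norm ?hn_ge0//.
  have -> : l (c *: f) - c *: l f =
      (l (c *: f) - val (u n) (c *: f)) + (- c) *: (l f - val (u n) f).
    by rewrite bopZ scaleNr scalerBr opprB addrA subrK.
  rewrite (le_trans (ler_hnD _ _))// mulrDr lerD// hnZ normrN mulrCA.
  by rewrite ler_wpM2l// normc_def/= sqrtr_ge0.
have lb : bounded_by l (e 0%N + opn (u 0%N)).
  move=> f; rewrite -[l f](subrK (val (u 0%N) f)).
  by rewrite (le_trans (ler_hnD _ _))// mulrDl lerD// opn_bound.
have lP : l \in @bop_pred R X.
  apply/asboolP; exists l', (e 0%N + opn (u 0%N)); split=> //.
  by rewrite addr_ge0 ?opn_ge0.
exists (exist (fun l => l \in @bop_pred R X) l lP) => n.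
by apply: opn_le => // f; rewrite bopBE /= hl.
Qed.

Fact bop_complete (F : set_system B) : ProperFilter F -> cauchy F -> cvg F.
Proof. exact: sequentially_complete bop_cauchy_seq_lim F. Qed.

HB.instance Definition _ := Uniform_isComplete.Build (bop R X) bop_complete.

Lemma bop_comp_subproof S T : (fun f => val S (val T f)) \in @bop_pred R X.
Proof.
apply/asboolP; exists (fun g => adj T (adj S g)), (opn S * opn T); split.
- by move=> c f; rewrite !bopZ.
- by move=> f g; rewrite !adjP.
- by rewrite mulr_ge0 ?opn_ge0.
- move=> f; rewrite (le_trans (opn_bound _ _))// -mulrA.
  by rewrite ler_wpM2l ?opn_ge0// opn_bound.
Qed.
Definition bop_comp S T : B := exist (fun l => l \in @bop_pred R X) _ (bop_comp_subproof S T).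

Lemma bop_star_subproof T : adj T \in @bop_pred R X.
Proof.
apply/asboolP; exists (val T), (opn T); split.
- exact: adjoint_homogeneous (@adjP T) (@bopZ T).
- exact/adjoint_sym/adjP.
- exact: opn_ge0.
- exact: adjoint_bounded (opn_ge0 T) (@adjP T) (@opn_bound T).
Qed.
Definition bop_star T : B := exist (fun l => l \in @bop_pred R X) _ (bop_star_subproof T).

Lemma bop_starP S T : adjoint_to (val T) (val S) -> bop_star T = S.
Proof.
move=> TS; apply: val_inj; exact: adjoint_unique (@adjP T) TS.
Qed.

Lemma ip_bop_star T f g : ip (val T f) g = ip f (val (bop_star T) g).
Proof. exact: adjP. Qed.

Fact bop_compA : associative bop_comp.
Proof. by move=> S T U; apply: bop_ext. Qed.
Fact bop_compDl : left_distributive bop_comp +%R.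
Proof. by move=> S T U; apply: bop_ext. Qed.
Fact bop_compDr : right_distributive bop_comp +%R.
Proof. by move=> S T U; apply: bop_ext => f /=; rewrite bopD. Qed.
Fact bop_compZl c S T : bop_comp (c *: S) T = c *: bop_comp S T.
Proof. exact: bop_ext. Qed.
Fact bop_compZr c S T : bop_comp S (c *: T) = c *: bop_comp S T.
Proof. by apply: bop_ext => f; rewrite /= bopZ. Qed.
Fact bop_starK : involutive bop_star.
Proof. by move=> T; apply: bop_starP; exact/adjoint_sym/adjP. Qed.
Fact bop_starD : {morph bop_star : S T / S + T}.
Proof.
move=> S T; apply: bop_starP => f g.
by rewrite !bopDE ipDl ipDr !ip_bop_star.
Qed.
Fact bop_starZ c T : bop_star (c *: T) = Num.conj c *: bop_star T.
Proof.
apply: bop_starP => f g; rewrite !bopZE ipZl ip_bop_star.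
by rewrite -[in RHS](bopZ (bop_star T)).
Qed.
Fact bop_starM S T : bop_star (bop_comp S T) = bop_comp (bop_star T) (bop_star S).
Proof. by apply: bop_starP => f g /=; rewrite !adjP. Qed.

Fact opn_comp S T : opn (bop_comp S T) <= opn S * opn T.
Proof.
apply: opn_le => [|f]; first by rewrite mulr_ge0 ?opn_ge0.
apply: (le_trans (opn_bound S (val T f))).
by rewrite -mulrA ler_wpM2l ?opn_ge0// opn_bound.
Qed.

Fact bop_norm_comp S T : `|bop_comp S T| <= `|S| * `|T|.
Proof. by rewrite !nrmE -rmorphM lecR opn_comp. Qed.

Fact bop_norm_star_comp T : `|bop_comp (bop_star T) T| = `|T| ^+ 2.
Proof.
rewrite !nrmE -rmorphXn; congr (_%:C); rewrite !nrm_bop; apply/le_anti/andP; split.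
  rewrite (le_trans (opn_comp _ _))// expr2 ler_wpM2r ?opn_ge0//.
  apply: opn_le (opn_ge0 _) _; exact: adjoint_bounded (opn_ge0 T) (@adjP T) (@opn_bound T).
rewrite -(@sqr_sqrtr _ (opn (bop_comp (bop_star T) T))) ?opn_ge0//.
rewrite ler_pXn2r ?nnegrE ?opn_ge0 ?sqrtr_ge0//; apply: opn_le; first exact: sqrtr_ge0.
move=> f; rewrite -(ler_pXn2r (n := 2)) ?nnegrE ?mulr_ge0 ?hn_ge0 ?sqrtr_ge0//.
rewrite exprMn [X in _ <= X * _]sqr_sqrtr ?opn_ge0// [leLHS]hn_sq -ipff ip_bop_star.
apply: (le_trans (ip_le _ _)).
have := opn_bound (bop_comp (bop_star T) T) f; have := hn_ge0 f => /=; nra.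
Qed.

HB.instance Definition _ := CompleteNormedModule_isCstar.Build R (bop R X)
  bop_compA bop_compDl bop_compDr bop_compZl bop_compZr bop_starK bop_starD
  bop_starZ bop_starM bop_norm_comp bop_norm_star_comp.

End OperatorNorm.

(** * A Cuntz-Krieger family with nonzero vertex projections *)

Section PartialShift.
Variables (R : realType) (X : choiceType).
Local Notation H := (l2 R X).

Record pbij := PBij {
  pfwd : X -> option X;
  pbwd : X -> option X;
  pbijP : forall x y, pfwd x = Some y <-> pbwd y = Some x }.

Definition pinv (a : pbij) : pbij :=
  @PBij (pbwd a) (pfwd a) (fun x y => iff_sym (pbijP a y x)).

(** Composition with the partial map, extended by zero: the operator carries functions from the
    range of [pfwd a] back to its domain. *)
Definition shift_fun (a : pbij) (f : X -> R[i]^o) : X -> R[i]^o :=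
  fun x => if pfwd a x is Some y then f y else 0.

Lemma reindex_pbij (a : pbij) (u : X -> \bar R) :
  \esum_(x in [set: X]) (if pfwd a x is Some y then u y else 0%E) =
  \esum_(y in [set: X]) (if pbwd a y is Some _ then u y else 0%E).
Proof.
have restrict (b : X -> option X) (w w' : X -> \bar R) :
    (forall x, b x != None -> w x = w' x) ->
    \esum_(x in [set: X]) (if b x is Some _ then w x else 0%E) =
    \esum_(x in [set x | b x != None]) w' x.
  move=> ww'; rewrite [RHS]esum_mkcond; apply: eq_esum => x _.
  case: ifPn => [/set_mem/=|/negP].
    by move=> bx; rewrite -ww'//; case: (b x) bx.
  by move=> nb; case E : (b x) => //; case: nb; apply/mem_set; rewrite /= E.
rewrite (restrict (pbwd a) u u)//.
have -> : \esum_(x in [set: X]) (if pfwd a x is Some y then u y else 0%E) =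
    \esum_(x in [set: X])
      (if pfwd a x is Some _ then u (odflt x (pfwd a x)) else 0%E).
  by apply: eq_esum => x _; case: (pfwd a x).
rewrite (restrict (pfwd a) _ (fun x => u (odflt x (pfwd a x))))//.
apply/esym/reindex_esum; split.
- move=> x /=; case E : (pfwd a x) => [y|//] _ /=.
  by move/pbijP : E => ->.
- move=> x y /set_mem/= hx /set_mem/= hy.
  case E : (pfwd a x) hx => [z|//] _ /=.
  case E' : (pfwd a y) hy => [z'|//] _ /= zz.
  by move: E E'; rewrite -zz => /pbijP + /pbijP => -> [].
- move=> y /=; case E : (pbwd a y) => [x|//] _; exists x => /=.
    by move/pbijP : E => ->.
  by move/pbijP : E => ->.
Qed.

Lemma sqmod0 : sqmod (0 : R[i]) = 0.
Proof. by rewrite /sqmod/= expr0n addr0. Qed.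

Lemma shift_backforth (a : pbij) f x : shift_fun (pinv a) (shift_fun a f) x =
  if pbwd a x is Some _ then f x else 0.
Proof.
rewrite /shift_fun/=; case E : (pbwd a x) => [y|//].
by move/pbijP : E => ->.
Qed.

Lemma sqsum_shift (a : pbij) f : sqsum (shift_fun a f) =
  sqsum (shift_fun (pinv a) (shift_fun a f)).
Proof.
rewrite /sqsum; transitivity (\esum_(x in [set: X])
    (if pfwd a x is Some y then (sqmod (f y))%:E else 0%E)).
  apply: eq_esum => x _; rewrite /shift_fun; case: (pfwd a x) => //.
  by rewrite sqmod0.
rewrite reindex_pbij; apply: eq_esum => y _; rewrite shift_backforth.
by case: (pbwd a y) => //; rewrite sqmod0.
Qed.

Lemma sqsum_shift_le (a : pbij) f : (sqsum (shift_fun a f) <= sqsum f)%E.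
Proof.
rewrite sqsum_shift; apply: le_esum => x _; rewrite shift_backforth lee_fin.
by case: (pbwd a x) => //; rewrite sqmod0 sqmod_ge0.
Qed.

Lemma shift_l2 (a : pbij) (f : H) : shift_fun a (val f) \in @l2_pred R X.
Proof. by rewrite inE; have := valP f; apply: le_lt_trans; exact: sqsum_shift_le. Qed.

Definition shift (a : pbij) (f : H) : H :=
  exist (fun f => f \in @l2_pred R X) _ (shift_l2 a f).

Lemma shiftE (a : pbij) f x :
  val (shift a f) x = if pfwd a x is Some y then val f y else 0.
Proof. by []. Qed.

Lemma shift_invE (a : pbij) f x :
  val (shift (pinv a) (shift a f)) x = if pbwd a x is Some _ then val f x else 0.
Proof. exact: shift_backforth. Qed.

Lemma sqn_shift (a : pbij) f : sqn (shift a f) = sqn (shift (pinv a) (shift a f)).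
Proof. by apply: EFin_inj; rewrite !sqnE; exact: sqsum_shift. Qed.

Lemma ip_disjoint (f g : H) : (forall x, val f x = 0 \/ val g x = 0) -> ip f g = 0.
Proof.
move=> fg; have := @sqn_sum R X [:: f + g] [:: f; g].
rewrite !big_cons !big_nil => h; rewrite /ip.
suff : sqn (f + g) + 0 = sqn f + (sqn g + 0) by lra.
apply: h => x; rewrite !big_cons !big_nil l2DE.
by case: (fg x) => ->; rewrite sqmod0 ?add0r ?addr0.
Qed.

Lemma shiftD a f g : shift a (f + g) = shift a f + shift a g.
Proof.
by apply: l2_ext => x; rewrite l2DE !shiftE; case: (pfwd a x) => //; rewrite addr0.
Qed.

(* By polarization [shift a] is isometric between the two ranges, and
   functions supported off a range are orthogonal to it. *)
Lemma shift_adjoint a : adjoint_to (shift a) (shift (pinv a)).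
Proof.
move=> f g; pose g' := shift (pinv a) g.
pose Q := fun h => shift (pinv a) (shift a h).
have Qg' : Q g' = g'.
  by apply: l2_ext => x; rewrite shift_invE /g' shiftE /=; case: (pbwd a x).
have iso h k : ip (shift a h) (shift a k) = ip (Q h) (Q k).
  by rewrite /ip /Q -!shiftD -!sqn_shift.
have -> : ip (shift a f) g = ip (shift a f) (shift a g' + (g - shift a g')).
  by rewrite addrC subrK.
rewrite ipDr [X in _ + X]ip_disjoint; last first.
  move=> x; rewrite l2BE [val (shift a g') x](shift_invE (pinv a)) shiftE /=.
  by case: (pfwd a x) => [y|]; [right; rewrite subrr|left].
have -> : ip f (shift (pinv a) g) = ip (Q f + (f - Q f)) g' by rewrite addrC subrK.
rewrite addr0 iso Qg' ipDl [X in _ = _ + X]ip_disjoint ?addr0// => x.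
rewrite l2BE /Q shift_invE /g' shiftE /=.
by case: (pbwd a x) => [y|]; [left; rewrite subrr|right].
Qed.

Lemma shift_bop a : shift a \in @bop_pred R X.
Proof.
apply/asboolP; exists (shift (pinv a)), 1; split=> //.
- move=> c f; apply: l2_ext => x; rewrite l2ZE !shiftE.
  by case: (pfwd a x) => //; rewrite mulr0.
- exact: shift_adjoint.
- move=> f; rewrite mul1r -(ler_pXn2r (n := 2)) ?nnegrE ?hn_ge0// !hn_sq.
  by rewrite -lee_fin !sqnE sqsum_shift_le.
Qed.

Definition shift_op a : bop R X := exist (fun T => T \in @bop_pred R X) _ (shift_bop a).

Lemma shift_op_star a : (shift_op a)^# = shift_op (pinv a).
Proof. by apply: bop_starP; exact: shift_adjoint. Qed.

Lemma bop_ext2 (S T : bop R X) :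
  (forall f x, val (val S f) x = val (val T f) x) -> S = T.
Proof. by move=> h; apply: bop_ext => f; apply: l2_ext. Qed.

Lemma val_bop_sum (I : Type) (r : seq I) (F : I -> bop R X) f x :
  val (val (\sum_(i <- r) F i) f) x = \sum_(i <- r) val (val (F i) f) x.
Proof.
elim: r => [|i r IH]; first by rewrite !big_nil.
by rewrite !big_cons bopDE l2DE IH.
Qed.

Lemma shift_op_comp_starE a f x :
  val (val (shift_op a ** (shift_op a)^#) f) x =
  if pfwd a x is Some _ then val f x else 0.
Proof. by rewrite shift_op_star; exact: (shift_invE (pinv a)). Qed.

Lemma shift_op_star_compE a f x :
  val (val ((shift_op a)^# ** shift_op a) f) x =
  if pbwd a x is Some _ then val f x else 0.
Proof. by rewrite shift_op_star; exact: shift_invE. Qed.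

Lemma shift_op_eq0 a x : pfwd a x <> None -> shift_op a <> 0.
Proof.
case E : (pfwd a x) => [y|//] _ a0.
pose d : X -> R[i]^o := fun z => if z \in [set y] then 1 else 0.
have dl : d \in @l2_pred R X.
  rewrite inE /sqsum.
  have -> : \esum_(z in [set: X]) (sqmod (d z))%:E = \esum_(z in [set y]) 1%:E.
    rewrite [RHS]esum_mkcond; apply: eq_esum => z _; rewrite /d.
    by case: ifP => _; rewrite ?sqmod0// /sqmod/= expr1n expr0n addr0.
  by rewrite esum_set1 ?ltry.
pose D : H := exist (fun f => f \in @l2_pred R X) d dl.
have := congr1 (fun T : bop R X => val (val T D) x) a0.
rewrite /= /shift_fun E /d mem_set// => /eqP.
by rewrite oner_eq0.
Qed.

End PartialShift.

(* Each vertex projection has range l2(nat); a bijection between nat and the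
   disjoint union of copies of nat, one per edge into [v], gives the edges. *)
Section Model.
Variables (R : realType) (E : digraph).
Hypothesis Erf : row_finite E.
Local Notation X := (vertex E * nat)%type.

Definition edge_rank (e : edge E) := index e (in_edges (rng e)).
Definition in_degree (v : vertex E) := size (in_edges v).

Lemma edge_rank_lt e : (edge_rank e < in_degree (rng e))%N.
Proof. by rewrite index_mem (mem_in_edges Erf). Qed.

Definition vertex_fwd (v : vertex E) (x : X) : option X :=
  if x.1 == v then Some x else None.

Fact vertex_fwdP v x y : vertex_fwd v x = Some y <-> vertex_fwd v y = Some x.
Proof.
by rewrite /vertex_fwd; split; case: ifP => // h [<-]; rewrite h.
Qed.

(** The residues modulo the in-degree are shared out among the edges into a vertex: [e] owns the
    residue [edge_rank e], and the quotient is the position at its source. *)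
Definition edge_fwd (e : edge E) (x : X) : option X :=
  if (x.1 == rng e) && (x.2 %% in_degree (rng e) == edge_rank e)%N
  then Some (src e, (x.2 %/ in_degree (rng e))%N) else None.

Definition edge_bwd (e : edge E) (x : X) : option X :=
  if x.1 == src e
  then Some (rng e, x.2 * in_degree (rng e) + edge_rank e)%N else None.

Fact edge_fwdP e x y : edge_fwd e x = Some y <-> edge_bwd e y = Some x.
Proof.
have rk := edge_rank_lt e; have k0 : (0 < in_degree (rng e))%N by apply: leq_ltn_trans rk.
case: x y => [v m] [w k]; rewrite /edge_fwd /edge_bwd /=; split.
  case: ifP => // /andP[/eqP -> /eqP <-] [<- <-].
  by rewrite eqxx -divn_eq.
case: ifP => // /eqP -> [<- <-].
by rewrite eqxx modnMDl modn_small// eqxx divnMDl// divn_small// addn0.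
Qed.

Definition model_p (v : vertex E) : bop R X :=
  shift_op R (PBij (vertex_fwdP v)).
Definition model_s (e : edge E) : bop R X :=
  shift_op R (PBij (edge_fwdP e)).

Lemma model_p_neq0 v : model_p v <> 0.
Proof. by apply: (@shift_op_eq0 _ _ _ (v, 0%N)); rewrite /= /vertex_fwd eqxx. Qed.

Lemma model_pE v f x : val (val (model_p v) f) x = if x.1 == v then val f x else 0.
Proof. by rewrite /= /shift_fun /= /vertex_fwd; case: ifP. Qed.

Lemma model_CK_family : CK_family model_s model_p.
Proof.
split.
- split=> [v|v w vw].
    split; last by rewrite shift_op_star; exact: bop_ext2.
    apply: bop_ext2 => f x; rewrite -[LHS]/(val (val (model_p v) (val (model_p v) f)) x).
    by rewrite !model_pE; case: (x.1 == v).
  apply: bop_ext2 => f x; rewrite -[LHS]/(val (val (model_p v) (val (model_p w) f)) x).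
  rewrite !model_pE; case: eqP => // ->; case: eqP => // vw'.
- move=> e; apply: bop_ext2 => f x.
  rewrite -[LHS]/(val (val (model_s e ** (model_s e)^#) (val (model_s e) f)) x).
  rewrite shift_op_comp_starE /= /shift_fun /=.
  by case: (edge_fwd e x).
- move=> e; apply: bop_ext2 => f x; rewrite shift_op_star_compE model_pE /= /edge_bwd.
  by case: ifP.
- move=> v [e1 /= e1v]; apply: bop_ext2 => f [w m].
  rewrite model_pE fsbig_finite// val_bop_sum -[(w, m).1]/w.
  rewrite (eq_bigr (fun e => if (w == rng e) && (m %% in_degree (rng e) == edge_rank e)%N
      then val f (w, m) else 0)); last first.
    by move=> e _; rewrite shift_op_comp_starE /= /edge_fwd /=; case: ifP.
  rewrite -[finmap.enum_fset _]/(in_edges v).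
  case: eqP => [->{w}|wv]; last first.
    by rewrite big_seq big1// => e; rewrite (mem_in_edges Erf) => /eqP ->; case: eqP.
  have mk : (m %% in_degree v < in_degree v)%N.
    by rewrite ltn_mod -e1v (leq_ltn_trans _ (edge_rank_lt e1)).
  (* The one edge that owns the residue of [m]; all other summands vanish at this point. *)
  pose e0 := nth e1 (in_edges v) (m %% in_degree v).
  have e0v : e0 \in in_edges v by exact: mem_nth.
  have /eqP re0 : rng e0 == v by rewrite -(mem_in_edges Erf).
  rewrite (bigD1_seq e0) ?in_edges_uniq//= re0 eqxx /edge_rank re0.
  rewrite index_uniq ?in_edges_uniq// eqxx big_seq_cond big1 ?addr0// => e.
  move=> /andP[ev ne]; have /eqP -> : rng e == v by rewrite -(mem_in_edges Erf).
  case: ifP => // /andP[_ /eqP me].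
  by move: ne; rewrite /e0 me nth_index// eqxx.
Qed.

End Model.

Lemma graph_cstar_vertex_neq0 (R : realType) (E : digraph) (A : cstarAlgType R)
    (s : edge E -> A) (p : vertex E -> A) :
  row_finite E -> graph_cstar_algebra s p -> forall v, p v <> 0.
Proof.
move=> Erf [_ _ univ] v pv0.
have [phi [phiH _ phip]] := univ _ _ _ (model_CK_family R Erf).
by apply: (@model_p_neq0 R E v); rewrite -phip pv0 (star_hom0 phiH).
Qed.

Theorem theorem3p5 (R : realType) (E : digraph)
    (A : cstarAlgType R) (s : edge E -> A) (p : vertex E -> A)
    (gam : complex R -> A -> A) (J : set A) :
  row_finite E ->
  condition_L E ->
  graph_cstar_algebra s p ->
  gauge_action s p gam ->
  regular_ideal J ->
  gauge_invariant gam J ->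
  condition_L (ideal_quotient_graph p J).
Proof.
move=> Erf EL ACE gamP Jreg Jgam.
have [CK Agen _] := ACE.
apply: (quotient_condition_L Erf CK Agen gamP Jgam Jreg) EL.
exact: graph_cstar_vertex_neq0 ACE.
Qed.
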